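(* Let $s_0,m,\ell,\ell'\ge 0$ be real numbers, let $s_1\geq s_0+\max\{m,\ell\}$ and $\delta>s_1+\ell'$. Then, for $S$ large enough (i.e. for all $S$ larger than some threshold depending only on $s_0,m,\ell,\ell',s_1,\delta$), the following holds. Let $(V_s,\Vert\cdot\Vert_s)_{0\le s\le S}$ and $(W_s,\Vert\cdot\Vert'_s)_{0\le s\le S}$ be tame Banach scales with projections $\Pi(\Lambda)$, $\Pi'(\Lambda)$ and ranges $E(\Lambda)$, $E'(\Lambda)$ respectively ($\Lambda\in[1,\infty)$). Let $F:B_{s_0+m}\to W_{s_0}$ be $S$-tame differentiable with $F(0)=0$, and assume that $DF$ is tame right-invertible, with associated parameters $s_0,m,\ell,\ell'$. Assume in addition that for each $\Lambda,\Lambda'\in[1,\infty)$ the map $$u\in B_{s_0+\max\{m,\ell\}}\cap E(\Lambda)\ \mapsto\ \Pi'(\Lambda')\,DF(u)\!\upharpoonright_{E(\Lambda)}\ \in\ \mathcal{L}(E(\Lambda),E'(\Lambda'))$$ is continuous for the norms $\Vert\cdot\Vert_{s_0}$ (on $E(\Lambda)$) and $\Vert\cdot\Vert'_{s_0}$ (on $E'(\Lambda')$). Then there exist a radius $r>0$ and a continuous map $G:B'_\delta(0,r)\to B_{s_1}$ (continuous for the norms $\Vert\cdot\Vert'_\delta$ and $\Vert\cdot\Vert_{s_1}$) such that $$G(0)=0,\qquad F\circ G=I_{B'_\delta(0,r)},$$ $$\Vert G(v)\Vert_{s_1}\leq r^{-1}\Vert v\Vert'_\delta\quad\text{for all } v\in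 B'_\delta(0,r).$$
   Context: Banach scale: a family of Banach spaces $(V_s,\Vert\cdot\Vert_s)_{0\le s\le S}$ such that $0\le s_1\le s_2\le S$ implies $V_{s_2}\subset V_{s_1}$ and $\Vert\cdot\Vert_{s_1}\le\Vert\cdot\Vert_{s_2}$ on $V_{s_2}$. Tame Banach scale: a Banach scale endowed with a family of continuous linear projections $\Pi(\Lambda)$ on $V_0$, $\Lambda\in[1,\infty)$, with range $E(\Lambda)\subset V_S$, such that $\Pi(\Lambda)\Pi(\Lambda')=\Pi(\Lambda')\Pi(\Lambda)=\Pi(\Lambda)$ for $1\le\Lambda\le\Lambda'$, and such that there are constants $A_1,A_2\ge1$ with, for all $0\le s\le S$, all $\Lambda\in[1,\infty)$ and all $u\in V_s$: $$\forall t\in[0,S],\ \Vert\Pi(\Lambda)u\Vert_t\le A_1\Lambda^{(t-s)^+}\Vert u\Vert_s;\qquad \forall t\in[0,s],\ \Vert(1-\Pi(\Lambda))u\Vert_t\le A_2\Lambda^{-(s-t)}\Vert u\Vert_s .$$ For the second tame scale $(W_s,\Vert\cdot\Vert'_s)$ the projections on $W_0$ are $\Pi'(\Lambda)$, with ranges $E'(\Lambda)\subset W_S$ and constants $A_1',A_2'$. Balls: $B_s=\{u\in V_s:\Vert u\Vert_s<1\}$ and $B'_s(0,r)=\{v\in W_s:\Vert v\Vert'_s<r\}$. $S$-tame differentiability: $F:B_{s_0+m}\to W_{s_0}$ is $S$-tame differentiable if it satisfies the following two requirements. First, $F$ is Gâteaux-differentiable (G-differentiable), meaning that for every $u\in B_{s_0+m}$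 there is a linear map $DF(u):V_{s_0+m}\to W_{s_0}$ such that for every $s\in[s_0,S-m]$, if $u\in B_{s_0+m}\cap V_{s+m}$, then $DF(u)$ maps $V_{s+m}$ continuously into $W_s$ and $$\forall h\in V_{s+m},\quad \lim_{t\to0}\left\Vert\frac1t\left[F(u+th)-F(u)\right]-DF(u)h\right\Vert'_s=0 .$$ Second, for some constant $a>0$ and all $s\in[s_0,S-m]$, if $u\in B_{s_0+m}\cap V_{s+m}$ and $h\in V_{s+m}$, then $DF(u)h\in W_s$ with $$\Vert DF(u)h\Vert'_s\le a\left(\Vert h\Vert_{s+m}+\Vert u\Vert_{s+m}\Vert h\Vert_{s_0+m}\right).$$ Tame right-invertibility (with parameters $\ell,\ell'\ge0$): there is $b>0$ such that for all $u\in B_{s_0+\max\{m,\ell\}}$ there is a linear map $L(u):W_{s_0+\ell'}\to V_{s_0}$ satisfying $$DF(u)L(u)k=k\quad\text{for all }k\in W_{s_0+\ell'}\text{ such that }L(u)k\in V_{s_0+m},$$ and such that for all $s_0\le s\le S-\max\{\ell,\ell'\}$, if $u\in B_{s_0+\max\{m,\ell\}}\cap V_{s+\ell}$ and $k\in W_{s+\ell'}$, then $L(u)k\in V_s$ with $$\Vert L(u)k\Vert_s\le b\left(\Vert k\Vert'_{s+\ell'}+\Vert k\Vert'_{s_0+\ell'}\Vert u\Vert_{s+\ell}\right).$$ $\mathcal{L}(E(\Lambda),E'(\Lambda'))$ is the space of bounded linear operators from $(E(\Lambda),\Vert\cdot\Vert_{s_0})$ to $(E'(\Lambda'),\Vert\cdot\Vert'_{s_0})$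 with the operator norm. *)

(* Defs.v *)
From HB Require Import structures.
From mathcomp Require Import all_boot all_order all_algebra.
From mathcomp Require Import all_classical all_reals all_analysis.

Set Implicit Arguments.
Unset Strict Implicit.
Unset Printing Implicit Defensive.

Import Order.TTheory GRing.Theory Num.Theory.
Import numFieldNormedType.Exports.

Local Open Scope classical_set_scope.
Local Open Scope ring_scope.

(* [D] is a linear subspace of [V] which is a Banach space for the norm [N];
   the values of [N] outside [D] are irrelevant. *)
Definition banach_subspace (R : realType) (V : lmodType R)
    (D : set V) (N : V -> R) : Prop :=
  exists (B : completeNormedModType R) (j : {linear B -> V}),
    [/\ injective j, range j = D & forall x, N (j x) = `|x|].

(* All the spaces V_s live inside the largest one, V_0, which is the carrier.
   [sspace] and [snorm] are meaningful only for indices in [0, S], and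
   [snorm s] only on [sspace s]. *)
Record banachScale (R : realType) (S : R) := BanachScale {
  scale0 :> completeNormedModType R;
  sspace : R -> set scale0;
  snorm : R -> scale0 -> R;
  sspace0 : sspace 0 = setT;
  snorm0 : forall u, snorm 0 u = `|u|;
  sspace_banach : forall s, 0 <= s -> s <= S ->
    banach_subspace (sspace s) (snorm s);
  sspace_sub : forall s1 s2, 0 <= s1 -> s1 <= s2 -> s2 <= S ->
    sspace s2 `<=` sspace s1;
  snorm_le : forall s1 s2, 0 <= s1 -> s1 <= s2 -> s2 <= S ->
    forall u, sspace s2 u -> snorm s1 u <= snorm s2 u
}.

Arguments sspace {R S} V s : rename.
Arguments snorm {R S} V s u : rename.

(* [proj L] is meaningful only for 1 <= L. *)
Record tameScale (R : realType) (S : R) := TameScale {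
  tscale :> banachScale S;
  proj : R -> {linear tscale -> tscale};
  proj_continuous : forall L, 1 <= L -> continuous (proj L);
  proj_range : forall L, 1 <= L -> range (proj L) `<=` sspace tscale S;
  proj_comp : forall L L', 1 <= L -> L <= L' ->
    forall u, proj L (proj L' u) = proj L u /\ proj L' (proj L u) = proj L u;
  proj_tame : exists A1 A2 : R, [/\ 1 <= A1, 1 <= A2 &
    forall s L, 0 <= s -> s <= S -> 1 <= L -> forall u, sspace tscale s u ->
      (forall t, 0 <= t -> t <= S ->
        snorm tscale t (proj L u) <=
          A1 * L `^ (Num.max (t - s) 0) * snorm tscale s u) /\
      (forall t, 0 <= t -> t <= s ->
        snorm tscale t (u - proj L u) <=
          A2 * L `^ (- (s - t)) * snorm tscale s u)]
}.
Arguments proj {R S} V L : rename.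

Definition sball (R : realType) (S : R) (V : banachScale S) (s r : R) : set V :=
  [set u | sspace V s u /\ snorm V s u < r].
Arguments sball {R S} V s r.

Definition linear_on (R : realType) (V W : lmodType R) (D : set V)
    (f : V -> W) : Prop :=
  forall (a : R) u v, D u -> D v -> f (a *: u + v) = a *: f u + f v.

(* Continuity of [f] on [D], from the norm of V_s to the norm of W_t. *)
Definition scontinuous_on (R : realType) (S : R) (V W : banachScale S)
    (s t : R) (D : set V) (f : V -> W) : Prop :=
  forall u, D u -> forall e, 0 < e -> exists2 d, 0 < d &
    forall v, D v -> snorm V s (v - u) < d -> snorm W t (f v - f u) < e.

(* The values of [F] outside the ball B_(s0+m), those of [DF u] for [u] outside
   that ball and those of [DF u h] for [h] outside V_(s0+m) are irrelevant. The
   limit in W_s presupposes that the difference quotients eventually lie in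
   W_s, as [snorm W s] means nothing elsewhere. *)
Definition G_differentiable (R : realType) (S : R) (V W : banachScale S)
    (s0 m : R) (F : V -> W) (DF : V -> V -> W) : Prop :=
  forall u, sball V (s0 + m) 1 u ->
    [/\ linear_on (sspace V (s0 + m)) (DF u),
        forall h, sspace V (s0 + m) h -> sspace W s0 (DF u h) &
        forall s, s0 <= s -> s <= S - m -> sspace V (s + m) u ->
          [/\ forall h, sspace V (s + m) h -> sspace W s (DF u h),
              scontinuous_on (s + m) s (sspace V (s + m)) (DF u) &
              forall h, sspace V (s + m) h ->
                (\forall t \near 0^',
                   sspace W s (t^-1 *: (F (u + t *: h) - F u))) /\
                snorm W s (t^-1 *: (F (u + t *: h) - F u) - DF u h)
                  @[t --> 0^'] --> 0]].

Definition tame_differentiable (R : realType) (S : R) (V W : banachScale S)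
    (s0 m : R) (F : V -> W) (DF : V -> V -> W) : Prop :=
  G_differentiable s0 m F DF /\
  exists2 a : R, 0 < a &
    forall s, s0 <= s -> s <= S - m ->
    forall u h, sball V (s0 + m) 1 u -> sspace V (s + m) u ->
      sspace V (s + m) h ->
      sspace W s (DF u h) /\
      snorm W s (DF u h) <=
        a * (snorm V (s + m) h + snorm V (s + m) u * snorm V (s0 + m) h).

Definition tame_right_invertible (R : realType) (S : R) (V W : banachScale S)
    (s0 m l l' : R) (DF : V -> V -> W) : Prop :=
  exists2 b : R, 0 < b &
    forall u, sball V (s0 + Num.max m l) 1 u ->
    exists Lu : W -> V,
      [/\ linear_on (sspace W (s0 + l')) Lu,
          forall k, sspace W (s0 + l') k -> sspace V s0 (Lu k),
          forall k, sspace W (s0 + l') k -> sspace V (s0 + m) (Lu k) ->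
            DF u (Lu k) = k &
          forall s, s0 <= s -> s <= S - Num.max l l' -> sspace V (s + l) u ->
          forall k, sspace W (s + l') k ->
            sspace V s (Lu k) /\
            snorm V s (Lu k) <=
              b * (snorm W (s + l') k +
                   snorm W (s0 + l') k * snorm V (s + l) u)].

(* Norm of an operator from ([E], norm of V_s) to W_s; it is extended real
   valued, so that an unbounded operator has norm +oo. *)
Definition opnorm (R : realType) (S : R) (V W : banachScale S) (s : R)
    (E : set V) (T : V -> W) : \bar R :=
  ereal_sup [set (snorm W s (T h))%:E | h in [set h | E h /\ snorm V s h <= 1]].

(* Continuity of u |-> Pi'(L') DF(u)|E(L) on B_(s0+max(m,l)) `&` E(L), into
   the bounded operators from E(L) to E'(L') with the operator norm. *)
Definition galerkin_continuous (R : realType) (S : R) (V W : tameScale S)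
    (s0 m l : R) (DF : V -> V -> W) (L L' : R) : Prop :=
  let E := range (proj V L) in
  let D := sball V (s0 + Num.max m l) 1 `&` E in
  let T := fun u h => proj W L' (DF u h) in
  (forall u, D u -> (opnorm s0 E (T u) < +oo)%E) /\
  forall u, D u -> forall e : R, 0 < e -> exists2 d : R, 0 < d &
    forall v, D v -> snorm V s0 (v - u) < d ->
      (opnorm s0 E (fun h => (T v h - T u h)%R) < e%:E)%E.

(* Main.v *)
(* Two ideas replace the usual Newton scheme.

   (1) A continuous form of Caristi's theorem. Let phi >= 0 be continuous on a
   complete metric space, and suppose that near each point with phi > 0 there is
   a continuous motion along which phi decreases at least as much as the
   distance travelled. Then the zero set of phi is a continuous retract: the
   local motions are assembled into a sequence of globally defined continuous
   maps, these are iterated, and the orbits converge locally uniformly by a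
   Dini argument. Applied to the residual phi = |Pi' F(u) - w|, this solves
   the Galerkin equation Pi' F(u) = w on the range of Pi with a solution
   depending continuously on the data; only the continuity of the derivative of
   Pi' F on the range of Pi and an approximate right inverse are needed.

   (2) A Nash-Moser iteration of Galerkin problems, following Ekeland and Sere.
   With lam_(n+1) = lam_n^(1/y) for some y < 1, the iterate
   u_(n+1) in E(lam_(n+1)) solves Pi'(lam_n) F(u_(n+1)) = Pi'(lam_n^y) v.
   Increments are measured in the norm |h|_s0 / p + |h|_tau / q, residuals in the
   norm |k|_(s0+l') / p + |k|_(tau+l') / q, with p = lam^(-(s1-s0)-eps) and
   q = lam^(beta-eps): for these norms the truncated right inverse
   Pi L(u) is bounded uniformly in n, whence geometric convergence in V_s1. *)
Require Import Defs.
From HB Require Import structures.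
From mathcomp Require Import all_boot all_order all_algebra.
From mathcomp Require Import all_classical all_reals all_analysis.
From mathcomp Require Import ring lra.
From mathcomp Require wochoice.
Import Order.TTheory GRing.Theory Num.Theory.
Import numFieldNormedType.Exports.
Local Open Scope classical_set_scope.
Local Open Scope ring_scope.
Set Implicit Arguments.
Unset Strict Implicit.
Unset Printing Implicit Defensive.

(* The bare name is shadowed by the projection of product topologies. *)
Local Notation proj := Defs.proj.

(** There is no explicit formula for G from which continuity could be read off: L(u) may depend on u
    in any way, and neither a second derivative nor a Lipschitz bound on DF is given, so Newton's
    quadratic error is missing as well. Solutions need not be unique either, since DF has only right
    inverses; solutions found separately for different v could not be compared afterwards. Hence
    every step treats the whole family of data v at once: the Caristi argument runs on pairs (v, u),
    its motions leave v fixed, and each motion freezes one direction computed from L at one point.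
    Continuity in v then comes from gluing the motions. The condition delta > s1 + l' enters at low
    frequencies: with L = lam_(n+1), consecutive targets differ in the norm of index s0 + l' by
    about L^(-y^3 (delta - s0 - l')), which has to stay below p = L^(-(s1 - s0) - eps). Some y < 1
    and eps > 0 allow this exactly when delta - l' > s1. *)

(** * Normed-space calculus and completeness inside one space of a scale *)

Section BanachScale.
Variables (R : realType) (S : R) (V : banachScale S) (s : R).
Hypotheses (s_ge0 : 0 <= s) (s_leS : s <= S).

Lemma sspace_lin (a : R) u v :
  sspace V s u -> sspace V s v -> sspace V s (a *: u + v).
Proof.
have [B [j [_ <- _]]] := sspace_banach V s_ge0 s_leS.
by move=> [x _ <-] [y _ <-]; exists (a *: x + y) => //; rewrite linearP.
Qed.

Lemma sspace_zero : sspace V s 0.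
Proof.
by have [B [j [_ <- _]]] := sspace_banach V s_ge0 s_leS; exists 0; rewrite ?linear0.
Qed.

Lemma sspaceD u v : sspace V s u -> sspace V s v -> sspace V s (u + v).
Proof. by move=> su sv; rewrite -[u]scale1r; exact: sspace_lin. Qed.

Lemma sspaceZ (a : R) u : sspace V s u -> sspace V s (a *: u).
Proof. by move=> su; rewrite -[_ *: _]addr0; apply: sspace_lin => //; exact: sspace_zero. Qed.

Lemma sspaceN u : sspace V s u -> sspace V s (- u).
Proof. by move=> su; rewrite -scaleN1r; exact: sspaceZ. Qed.

Lemma sspaceB u v : sspace V s u -> sspace V s v -> sspace V s (u - v).
Proof. by move=> su sv; apply: sspaceD => //; exact: sspaceN. Qed.

Lemma snormD u v : sspace V s u -> sspace V s v ->
  snorm V s (u + v) <= snorm V s u + snorm V s v.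
Proof.
have [B [j [_ <- jN]]] := sspace_banach V s_ge0 s_leS.
by move=> [x _ <-] [y _ <-]; rewrite -linearD !jN ler_normD.
Qed.

Lemma snormZ (a : R) u : sspace V s u -> snorm V s (a *: u) = `|a| * snorm V s u.
Proof.
have [B [j [_ <- jN]]] := sspace_banach V s_ge0 s_leS.
by move=> [x _ <-]; rewrite -linearZ/= !jN normrZ.
Qed.

Lemma snorm_zero : snorm V s 0 = 0.
Proof. by rewrite -(scale0r 0) snormZ ?normr0 ?mul0r//; exact: sspace_zero. Qed.

Lemma snormN u : sspace V s u -> snorm V s (- u) = snorm V s u.
Proof. by move=> su; rewrite -scaleN1r snormZ// normrN1 mul1r. Qed.

Lemma snorm_ge0 u : sspace V s u -> 0 <= snorm V s u.
Proof.
have [B [j [_ <- jN]]] := sspace_banach V s_ge0 s_leS.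
by move=> [x _ <-]; rewrite jN.
Qed.

Lemma snormB u v : sspace V s u -> sspace V s v ->
  snorm V s (u - v) <= snorm V s u + snorm V s v.
Proof.
move=> su sv; apply: le_trans (snormD su (sspaceN sv)) _.
by rewrite snormN.
Qed.

Lemma snorm_distC u v : sspace V s u -> sspace V s v ->
  snorm V s (u - v) = snorm V s (v - u).
Proof. by move=> su sv; rewrite -[u - v]opprB snormN//; exact: sspaceB. Qed.

Lemma snorm_eq0 u : sspace V s u -> snorm V s u = 0 -> u = 0.
Proof.
have [B [j [_ <- jN]]] := sspace_banach V s_ge0 s_leS.
by move=> [x _ <-]; rewrite jN => /normr0_eq0 ->; rewrite linear0.
Qed.

Lemma snorm_complete (u : nat -> V) : (forall k, sspace V s (u k)) ->
  (forall e : R, 0 < e -> exists n, forall i j, (n <= i)%N -> (n <= j)%N ->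
     snorm V s (u i - u j) < e) ->
  exists2 a, sspace V s a & forall e : R, 0 < e ->
    exists n, forall i, (n <= i)%N -> snorm V s (u i - a) < e.
Proof.
have [B [j [jI jr jN]]] := sspace_banach V s_ge0 s_leS => us Hu.
have /choice[x Hx] k : exists x, j x = u k.
  by have := us k; rewrite -jr => -[x _ <-]; exists x.
have cx : cvgn x.
  apply/cauchy_cvgP/cauchy_ballP => e e0; have [n Hn] := Hu e e0.
  exists (x @` [set i | (n <= i)%N], x @` [set i | (n <= i)%N]) => /=.
    by split; exists n => // i ni; exists i.
  move=> [_ _] /= [[i ni <-] [k nk <-]].
  by rewrite -ball_normE /= -jN linearB/= !Hx; exact: Hn.
have /cvgrPdist_lt cl : x @ \oo --> limn x by exact: cx.
exists (j (limn x)); first by rewrite -jr; exists (limn x).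
move=> e e0; have [n _ Hn] := cl e e0; exists n => i ni.
by rewrite -Hx -linearB jN distrC; exact: Hn.
Qed.

End BanachScale.

(** * The continuous Caristi theorem, on a pseudometric space *)

Section ContinuousCaristi.
Variables (R : realType) (T : choiceType) (d : T -> T -> R).
Hypothesis d_refl : forall x, d x x = 0.
Hypothesis d_sym : forall x y, d x y = d y x.
Hypothesis d_tri : forall x y z, d x z <= d x y + d y z.

(** The function is max(0, c - dist(x, S)). Adjoining 0 to [E x] performs the truncation and keeps
    the supremum meaningful when [S] is empty. *)
Lemma bump_function (S : set T) (c : R) : 0 < c -> exists w : T -> R,
  [/\ forall x, 0 <= w x <= c, forall x y, `|w x - w y| <= d x y,
      forall x, S x -> w x = c & forall x, 0 < w x -> exists2 y, S y & d x y < c].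
Proof.
move=> c0; have d_ge0 x y : 0 <= d x y.
  by have := d_tri x y x; rewrite d_refl (d_sym y x); lra.
pose E x := [set r : R | r = 0 \/ exists2 y, S y & r = c - d x y].
have ubE x : ubound (E x) c.
  by move=> r [->|[y _ ->]]; [exact: ltW|rewrite gerBl].
have supE x : has_sup (E x) by split; [exists 0; left|exists c; exact: ubE].
have leE x r : E x r -> r <= sup (E x).
  by move=> Er; apply: sup_upper_bound.
exists (fun x => sup (E x)); split.
- by move=> x; rewrite leE; [apply: ge_sup; [exists 0; left|exact: ubE]|left].
- have H x y : sup (E x) <= sup (E y) + d x y.
    apply: ge_sup; first by exists 0; left.
    move=> r [->|[z Sz ->]]; first by rewrite addr_ge0// leE//; left.
    have : c - d y z <= sup (E y) by apply: leE; right; exists z.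
    by have := d_tri y x z; rewrite (d_sym y x); lra.
  by move=> x y; rewrite ler_norml; have := H x y; have := H y x;
     rewrite (d_sym y x); lra.
- move=> x Sx; apply/eqP; rewrite eq_le; apply/andP; split.
    by apply: ge_sup; [exists 0; left|exact: ubE].
  by apply: leE; right; exists x => //; rewrite d_refl subr0.
- move=> x w0; have [r [->|[y Sy ->]]] := sup_adherent w0 (supE x).
    by rewrite subrr ltxx.
  by rewrite subrr subr_gt0 => dy; exists y.
Qed.

Variables (Q : Type) (p : T -> Q) (D : set T) (phi : T -> R).

(** The Lipschitz bound holds for all points and times, the decrease of [phi] only in [D] near [x].
    As time 0 gives the identity, a motion can be switched off by a bump function without a jump.
    The map [p] is a parameter that motions preserve, so that completeness is asked only inside a
    fibre of [p]. *)
Definition is_local_move (x : T) (e K : R) (h : R -> T -> T) :=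
  [/\ 0 < e, forall y, h 0 y = y,
      forall y y' t t', d (h t y) (h t' y') <= d y y' + K * `|t - t'| &
      forall y t, D y -> d x y < e -> 0 <= t -> t <= 1 ->
        [/\ D (h t y), p (h t y) = p y,
            d y (h t y) <= phi y - phi (h t y) &
            0 < t -> phi (h t y) < phi y]].

Definition continuous_in (f : T -> T) := forall x, D x -> forall e : R, 0 < e ->
  exists2 r : R, 0 < r & forall y, D y -> d x y < r -> d (f x) (f y) < e.

Hypothesis phi_continuous : forall x, D x -> forall e : R, 0 < e ->
  exists2 r : R, 0 < r & forall y, D y -> d x y < r -> `|phi x - phi y| < e.
Hypothesis local_moves : forall x, D x -> 0 < phi x ->
  exists e K h, is_local_move x e K h.

(* For fixed n, the points y such that the first neighbourhood (in a
   well-order) containing y contains its ball of radius 1/n form uniformly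
   separated families: this is Stone's argument for paracompactness. Since only
   one local move is active at a time, no partition of unity is needed. *)
Lemma global_moves : exists Phi : nat -> T -> T,
  [/\ forall n x, D x ->
        [/\ D (Phi n x), p (Phi n x) = p x &
            d x (Phi n x) <= phi x - phi (Phi n x)],
      forall n, continuous_in (Phi n) &
      forall x, D x -> 0 < phi x -> exists n, phi (Phi n x) < phi x].
Proof.
have d_ge0 x y : 0 <= d x y.
  by have := d_tri x y x; rewrite d_refl (d_sym y x); lra.
pose P x := D x /\ 0 < phi x.
have /choice[em Hem] x : exists em : R * R * (R -> T -> T),
    P x -> is_local_move x em.1.1 em.1.2 em.2.
  have [[Dx p0]|] := pselect (P x); last by exists (0, 0, fun=> id).
  by have [e [K [h H]]] := local_moves Dx p0; exists (e, K, h).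
pose e x := (em x).1.1; pose K x := (em x).1.2; pose h x := (em x).2.
have He x : P x -> is_local_move x (e x) (K x) (h x) by apply: Hem.
have e0 x : P x -> 0 < e x by move=> /He[].
have [le wole] := wochoice.well_ordering_principle T.
have leA x y : le x y -> le y x -> x = y.
  move=> xy yx.
  apply: (wochoice.wo_chain_antisymmetric (wochoice.withinW (A := predT) wole)).
  - by [].
  - by [].
  - by rewrite xy yx.
(* [idx y] is the first centre, in the well-order, whose ball contains [y]. *)
have /choice[idx Hidx] y : exists x, P y ->
    [/\ P x, d x y < e x & forall z, P z -> d z y < e z -> le x z].
  have [Py|] := pselect (P y); last by exists y.
  pose A : {pred T} := fun x => `[< P x /\ d x y < e x >].
  have [|x [[/asboolP[Px xe] lb] _]] := wole A.
    by exists y; apply/asboolP; split=> //; rewrite d_refl; exact: e0.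
  exists x => _; split=> // z Pz ze; apply: lb; apply/asboolP; split=> //.
pose c n : R := n.+1%:R^-1.
have c0 n : 0 < c n by rewrite invr_gt0 ltr0n.
have c1 n : c n <= 1 by rewrite invf_le1 ?ltr0n// ler1n.
pose S n := [set y | P y /\ forall z, d y z < c n -> d (idx y) z < e (idx y)].
have Ssep n y y' : S n y -> S n y' -> d y y' < c n -> idx y = idx y'.
  move=> [Py Hy] [Py' Hy'] yy'.
  have [Pi _ mi] := Hidx _ Py; have [Pi' _ mi'] := Hidx _ Py'.
  apply: leA; [apply: mi => //; apply: Hy'; by rewrite d_sym|].
  by apply: mi' => //; apply: Hy.
(* With bumps of width [c n / 4], two points less than [c n / 4] apart where the bump is positive
   are close to points of [S n] less than [c n] apart; by [Ssep] these have the same centre. *)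
have c40 n : 0 < c n / 4 by rewrite divr_gt0.
have /choice[w Hw] n := bump_function (S n) (c40 n).
have /choice[sel Hsel] (nx : nat * T) : exists y, 0 < w nx.1 nx.2 ->
    S nx.1 y /\ d nx.2 y < c nx.1 / 4.
  have [w0|] := pselect (0 < w nx.1 nx.2); last by exists nx.2.
  by have [_ _ _ /(_ _ w0)[y Sy dy]] := Hw nx.1; exists y.
pose a n x := idx (sel (n, x)).
(* The bump value is also the time for which the motion runs, so [Phi n] joins the identity
   continuously where the bump vanishes. *)
pose Phi n x := if 0 < w n x then h (a n x) (w n x) x else x.
have aP n x : 0 < w n x -> P (a n x) /\ d (a n x) x < e (a n x).
  move=> w0; have [[Py Hy] dy] := Hsel (n, x) w0.
  have [Pi _ _] := Hidx _ Py; split=> //; apply: Hy.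
  by rewrite d_sym (lt_le_trans dy)//=; have := c0 n; lra.
have aE n x x' : 0 < w n x -> 0 < w n x' -> d x x' < c n / 4 -> a n x = a n x'.
  move=> w0 w0' dx; have [Sy dy] := Hsel (n, x) w0.
  have [Sy' dy'] := Hsel (n, x') w0'; apply: (Ssep _ _ _ Sy Sy').
  set y := sel _ in Sy dy *; set y' := sel _ in Sy' dy' *.
  have := d_tri y x y'; have := d_tri x x' y'; rewrite (d_sym y x) /= in dy dy' *.
  by have := c0 n; lra.
exists Phi; split.
- move=> n x Dx; rewrite /Phi; case: ifPn => [w0|_]; last first.
    by split=> //; rewrite d_refl subrr.
  have [Pa da] := aP _ _ w0; have [_ _ _ H] := He _ Pa.
  have [/(_ x)/andP[w00 wc] _ _ _] := Hw n.
  by have [] := H x (w n x) Dx da w00; [have := c1 n; lra|].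
- move=> n x Dx eps eps0; have [wb wlip _ _] := Hw n.
  (* Either the bump is positive somewhere in the ball of radius [c n / 8], and then a single local
     motion describes [Phi n] on the whole ball, or [Phi n] is the identity there. *)
  have [[z0 [xz0 w0]]|none] := pselect (exists z, d x z < c n / 8 /\ 0 < w n z).
    set i := a n z0.
    have PhiE z : d x z < c n / 8 -> Phi n z = h i (w n z) z.
      move=> xz; rewrite /Phi; case: ifPn => [wz|].
        rewrite (aE _ _ z0)//; have := d_tri z x z0; rewrite (d_sym z x).
        by have := c0 n; lra.
      rewrite -leNgt => wz; have -> : w n z = 0.
        by apply/eqP; rewrite eq_le wz; have /andP[] := wb z.
      by have [_ -> _ _] := He _ (aP _ _ w0).1.
    have [_ _ hl _] := He _ (aP _ _ w0).1; rewrite -/i in hl.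
    have k0 : 0 < 1 + `|K i| by rewrite ltr_pwDl.
    exists (Num.min (c n / 8) (eps / (1 + `|K i|))).
      by rewrite lt_min !divr_gt0.
    move=> y Dy; rewrite lt_min => /andP[xy1]; rewrite ltr_pdivlMr// => xy2.
    rewrite !PhiE//; last by rewrite d_refl divr_gt0.
    apply: (le_lt_trans (hl _ _ _ _)); apply: le_lt_trans xy2.
    rewrite mulrDr mulr1 lerD2l (mulrC (d x y)).
    apply: (@le_trans _ _ (`|K i| * `|w n x - w n y|)).
      by rewrite ler_wpM2r// ler_norm.
    by rewrite ler_wpM2l.
  exists (Num.min (c n / 8) eps); first by rewrite lt_min eps0 divr_gt0.
  move=> y Dy; rewrite lt_min => /andP[xy1 xy2].
  have PhiE z : d x z < c n / 8 -> Phi n z = z.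
    by move=> xz; rewrite /Phi ifN//; apply/negP => w0; apply: none; exists z.
  by rewrite !PhiE// d_refl divr_gt0.
- move=> x Dx p0; have Px : P x by [].
  have [Pi di _] := Hidx _ Px.
  have [n nx] : exists n, c n < e (idx x) - d (idx x) x.
    have g0 : 0 < e (idx x) - d (idx x) x by rewrite subr_gt0.
    exists (Num.truncn (e (idx x) - d (idx x) x)^-1).
    by rewrite /c invf_plt ?posrE ?ltr0n// Num.Theory.truncnS_gt.
  exists n; have [_ _ wS _] := Hw n.
  have Sx : S n x.
    split=> // z xz; have := d_tri (idx x) x z.
    by move: nx xz; lra.
  have w0 : 0 < w n x by rewrite wS.
  rewrite /Phi w0; have [Pa da] := aP _ _ w0; have [_ _ _ H] := He _ Pa.
  have [/(_ x)/andP[w00 wc] _ _ _] := Hw n.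
  have w1 : w n x <= 1 by have := c1 n; lra.
  by have [_ _ _ /(_ w0)] := H x (w n x) Dx da w00 w1.
Qed.

Definition cauchy_in (x : nat -> T) := forall e : R, 0 < e ->
  exists n, forall i j, (n <= i)%N -> (n <= j)%N -> d (x i) (x j) < e.

Definition converges_to (x : nat -> T) (a : T) := forall e : R, 0 < e ->
  exists n, forall i, (n <= i)%N -> d (x i) a < e.

Hypothesis phi_ge0 : forall x, D x -> 0 <= phi x.
Hypothesis D_complete : forall x : nat -> T,
  (forall k, D (x k)) -> (forall k, p (x k) = p (x 0%N)) -> cauchy_in x ->
  exists a, [/\ D a, p a = p (x 0%N) & converges_to x a].

(* The iterates x_k satisfy d(x_k, lim) <= phi(x_k), and phi(x_k) decreases to
   0; as phi o x_k is continuous, the convergence is locally uniform, as in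
   Dini's theorem. *)
Lemma continuous_caristi : exists rho : T -> T,
  [/\ forall x, D x -> [/\ D (rho x), p (rho x) = p x, phi (rho x) = 0 &
        d x (rho x) <= phi x] & continuous_in rho].
Proof.
have d_ge0 x y : 0 <= d x y.
  by have := d_tri x y x; rewrite d_refl (d_sym y x); lra.
have [Phi [PhiD Phic Phis]] := global_moves.
(* The 2-adic valuation takes every value infinitely often, so each [Phi n] is applied again and
   again along the orbit. *)
pose X := fix X k x := if k is k'.+1 then Phi (logn 2 k) (X k' x) else x.
have XD k x : D x -> D (X k x) /\ p (X k x) = p x.
  by elim: k => [//|k IH] Dx /=; have [DX pX] := IH Dx;
     have [? -> _] := PhiD (logn 2 k.+1) _ DX.
have Xd k j x : D x -> d (X k x) (X (j + k)%N x) <= phi (X k x) - phi (X (j + k)%N x).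
  move=> Dx; elim: j => [|j IH]; first by rewrite d_refl subrr.
  have [DX pX] := XD (j + k)%N x Dx.
  have [_ _ /=] := PhiD (logn 2 (j + k).+1) _ DX.
  have := d_tri (X k x) (X (j + k)%N x) (Phi (logn 2 (j + k).+1) (X (j + k)%N x)).
  by lra.
have Xc k : continuous_in (X k).
  elim: k => [|k IH] x Dx e e0; first by exists e.
  have [DX _] := XD k x Dx; have [r r0 Hr] := Phic (logn 2 k.+1) _ DX e e0.
  have [r' r'0 Hr'] := IH x Dx r r0; exists r' => // y Dy xy /=.
  by apply: Hr; [have [] := XD k y Dy|apply: Hr'].
have Xph k j x : D x -> phi (X (j + k)%N x) <= phi (X k x).
  by move=> Dx; have := Xd k j x Dx; have := d_ge0 (X k x) (X (j + k)%N x); lra.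
have phiCau x : D x -> exists l : R, forall e : R, 0 < e ->
    exists n, forall i, (n <= i)%N -> l <= phi (X i x) < l + e.
  move=> Dx; pose A := [set phi (X k x) | k in [set: nat]].
  have A0 : has_inf A.
    split; first by exists (phi (X 0%N x)); exists 0%N.
    by exists 0 => _ [k _ <-]; apply: phi_ge0; have [] := XD k x Dx.
  exists (inf A) => e e0; have [_ [n _ <-] Hn] := inf_adherent e0 A0.
  exists n => i ni; apply/andP; split; first by apply: (ge_inf A0.2); exists i.
  by apply: le_lt_trans Hn; rewrite -(subnK ni); exact: Xph.
have lim_ex : forall x, D x -> exists a, [/\ D a, p a = p x & converges_to (fun k => X k x) a].
  move=> x Dx; apply: (D_complete (x := fun k => X k x)).
  - by move=> k; have [] := XD k x Dx.
  - by move=> k; have [] := XD k x Dx.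
  - move=> e e0; have [l Hl] := phiCau x Dx.
    have [n Hn] := Hl e e0; exists n.
    have H i j : (n <= i)%N -> (i <= j)%N -> d (X i x) (X j x) < e.
      move=> ni ij; have := Xd i (j - i)%N x Dx; rewrite subnK//.
      have := Hn i ni; have := Hn j (leq_trans ni ij) => /andP[? ?] /andP[? ?].
      by lra.
    move=> i j ni nj; have [ij|/ltnW ji] := leqP i j; first exact: H.
    by rewrite d_sym; exact: H.
have /choice[rho Hrho] : forall x, exists a, D x ->
    [/\ D a, p a = p x & converges_to (fun k => X k x) a].
  move=> x; have [/lim_ex[a Ha]|] := pselect (D x); last by exists x.
  by exists a.
have Xrho k x : D x -> d (X k x) (rho x) <= phi (X k x).
  move=> Dx; apply/ler_addgt0Pr => e e0.
  have [_ _ /(_ e e0)[n Hn]] := Hrho x Dx.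
  have := d_tri (X k x) (X (n + k)%N x) (rho x).
  have := Hn (n + k)%N (leq_addr _ _); have := Xd k n x Dx.
  by have := phi_ge0 (XD (n + k)%N x Dx).1; lra.
have rho0 x : D x -> phi (rho x) = 0.
  move=> Dx; have [Da pa xa] := Hrho x Dx.
  have := phi_ge0 Da; rewrite le_eqVlt => /orP[/eqP //|pa0].
  have [n Hn] := Phis _ Da pa0; exfalso.
  have [Db _ _] := PhiD n _ Da.
  set b := Phi n (rho x) in Hn Db.
  (* [Phi n] lowers [phi] by 4e at the limit, hence by more than 2e at late orbit points, although
     the values of [phi] on the orbit have settled to within e. *)
  pose e := (phi (rho x) - phi b) / 4.
  have e0 : 0 < e by rewrite divr_gt0// subr_gt0.
  have [l Hl] := phiCau x Dx.
  have [N1 HN1] := Hl e e0.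
  have [r1 r10 Hr1] := phi_continuous Da e0.
  have [r2 r20 Hr2] := phi_continuous Db e0.
  have [r3 r30 Hr3] := Phic n _ Da r2 r20.
  have m0 : 0 < Num.min r1 r3 by rewrite lt_min r10.
  have [N2 HN2] := xa _ m0.
  (* An odd multiple of 2^n beyond [N1 + N2]: the step from [K.-1] to [K] then applies [Phi n]. *)
  pose K := (2 ^ n * (N1 + N2).*2.+1)%N.
  have K0 : (0 < K)%N by rewrite muln_gt0 expn_gt0.
  have lK : logn 2 K = n.
    rewrite /K lognM ?expn_gt0// pfactorK// lognE /= dvdn2 /= odd_double /=.
    by rewrite addn0.
  have KN : (N1 + N2 <= K.-1)%N.
    rewrite -ltnS prednK// /K (leq_trans _ (leq_pmull _ _)) ?expn_gt0//.
    by rewrite ltnS -addnn leq_addr.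
  have DX := (XD K.-1 x Dx).1.
  have := HN2 K.-1 (leq_trans (leq_addl _ _) KN).
  rewrite d_sym lt_min => /andP[dX1 dX3].
  have := Hr1 _ DX dX1.
  have := Hr2 _ _ (Hr3 _ DX dX3) => /(_ _)/=; have [DP _ _] := PhiD n _ DX.
  move=> /(_ DP); rewrite -/b.
  have XK : Phi n (X K.-1 x) = X K x by rewrite -[in RHS](prednK K0) /= prednK// lK.
  rewrite XK !ltr_norml => /andP[? ?] /andP[? ?].
  have := HN1 K.-1 (leq_trans (leq_addr _ _) KN).
  have := HN1 K (leq_trans (leq_trans (leq_addr _ _) KN) (leq_pred _)).
  move=> /andP[? ?] /andP[? ?].
  have ee : 4 * e = phi (rho x) - phi b by rewrite /e mulrC divfK.
  by clear pa; lra.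
exists rho; split.
  by move=> x Dx; have [? ? _] := Hrho x Dx; split=> //; [exact: rho0|exact: (Xrho 0%N)].
move=> x Dx e e0; have e40 : 0 < e / 4 by rewrite divr_gt0.
have [k Hk] : exists k, phi (X k x) < e / 4.
  have [Da _ xa] := Hrho x Dx; have [r r0 Hr] := phi_continuous Da e40.
  have [n Hn] := xa r r0; exists n; have := Hr _ (XD n x Dx).1.
  by rewrite d_sym rho0// Hn// sub0r normrN => /(_ isT); apply: le_lt_trans; rewrite ler_norm.
have [r1 r10 Hr1] := phi_continuous (XD k x Dx).1 e40.
have [r2 r20 Hr2] := Xc k x Dx (Num.min r1 (e / 4)) ltac:(by rewrite lt_min r10).
exists r2 => // y Dy xy; have := Hr2 y Dy xy; rewrite lt_min => /andP[h1 h2].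
have := Hr1 _ (XD k y Dy).1 h1; rewrite ltr_norml => /andP[h3 h4].
have := Xrho k x Dx; have := Xrho k y Dy.
have := d_tri (rho x) (X k x) (rho y); have := d_tri (X k x) (X k y) (rho y).
by rewrite (d_sym (rho x) (X k x)); lra.
Qed.
End ContinuousCaristi.

(** * A mean value inequality for increments lying in a subspace *)

(** Compactness of [0, 1] in Cousin's form. The tag t is always an end point of the small interval,
    because a bound on difference quotients at t controls no other increments. The supremum of the t
    with [P 0 t] is attained and cannot be below 1. *)
Lemma cousin (R : realType) (P : R -> R -> Prop) :
  (forall a b c, a <= b -> b <= c -> P a b -> P b c -> P a c) ->
  (forall t, 0 <= t -> t <= 1 -> exists2 e, 0 < e &
     forall a, `|a - t| < e -> (a <= t -> P a t) /\ (t <= a -> P t a)) ->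
  P 0 1.
Proof.
move=> Ptr Ploc; pose A := [set t : R | 0 <= t <= 1 /\ P 0 t].
have A0 : A 0.
  split; first by rewrite lexx ler01.
  have [e e0 /(_ 0)] := Ploc 0 (lexx _) ler01.
  by rewrite subrr normr0 => /(_ e0)[/(_ (lexx _))].
have supA : has_sup A.
  by split; [exists 0|exists 1 => t [/andP[]]].
have s0 : 0 <= sup A by apply: sup_upper_bound.
have s1 : sup A <= 1 by apply: ge_sup; [exists 0|move=> t [/andP[]]].
have [e e0 He] := Ploc _ s0 s1.
have [t [/andP[t0 t1] Pt] tlt] := sup_adherent e0 supA.
have ts : t <= sup A by apply: sup_upper_bound => //; split=> //; rewrite t0.
have Ps : P 0 (sup A).
  apply: (Ptr _ t) => //; have [|+ _] := He t; last exact.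
  by rewrite ltr_norml; apply/andP; split; lra.
have [s1'|s1'] := ltP (sup A) 1; last first.
  by have -> : 1 = sup A by lra.
pose b := Num.min 1 (sup A + e / 2).
have sb : sup A < b by rewrite lt_min s1' ltrDl divr_gt0.
have Pb : P 0 b.
  apply: (Ptr _ (sup A)) => //; first exact: ltW.
  have [|_] := He b; last by apply; exact: ltW.
  have : b <= sup A + e / 2 by rewrite ge_min lexx orbT.
  by rewrite ltr_norml => ?; apply/andP; split; lra.
have : b <= sup A.
  apply: sup_upper_bound => //; split=> //.
  by rewrite (le_trans s0 (ltW sb))/= ge_min lexx.
by rewrite leNgt sb.
Qed.

(** [N] may be a mere seminorm and is controlled only on [D]; [g] may take values outside [D] as
    long as its increments lie in it. Both freedoms are used: values of F are compared in W_s
    through their differences, and later through the seminorm of the projected difference. *)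
Lemma mean_value (R : realType) (W : lmodType R) (D : set W) (N : W -> R)
    (g : R -> W) (K : R) :
  D 0 -> (forall (a : R) u v, D u -> D v -> D (a *: u + v)) ->
  (forall u v, D u -> D v -> N (u + v) <= N u + N v) ->
  (forall (a : R) u, D u -> N (a *: u) = `|a| * N u) ->
  (forall t e : R, 0 <= t -> t <= 1 -> 0 < e -> exists2 r, 0 < r &
     forall s, s != 0 -> `|s| < r ->
       D (s^-1 *: (g (t + s) - g t)) /\ N (s^-1 *: (g (t + s) - g t)) <= K + e) ->
  D (g 1 - g 0) /\ N (g 1 - g 0) <= K.
Proof.
move=> D0 Dlin ND NZ Hg.
have DZ (a : R) u : D u -> D (a *: u) by move=> Du; rewrite -[_ *: _]addr0; exact: Dlin.
have N0 : N 0 = 0 by rewrite -(scale0r 0) NZ// normr0 mul0r.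
have H e : 0 < e -> D (g 1 - g 0) /\ N (g 1 - g 0) <= (K + e) * (1 - 0).
  move=> e0.
  apply: (cousin (P := fun a b => D (g b - g a) /\ N (g b - g a) <= (K + e) * (b - a))).
    move=> a b c ab bc [Dab Nab] [Dbc Nbc].
    have -> : g c - g a = 1 *: (g c - g b) + (g b - g a) by rewrite scale1r addrA subrK.
    split; first exact: Dlin.
    by rewrite scale1r (le_trans (ND _ _ _ _))//; lra.
  move=> t t0 t1; have [r r0 Hr] := Hg t e t0 t1 e0; exists r => // a ar.
  have [->|at0] := eqVneq a t.
    by rewrite !subrr N0 mulr0.
  have [Dq Nq] : D ((a - t)^-1 *: (g a - g t)) /\ N ((a - t)^-1 *: (g a - g t)) <= K + e.
    by have := Hr (a - t); rewrite subr_eq0 at0 ar (addrC t) subrK; apply.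
  have at1 : a - t != 0 by rewrite subr_eq0.
  have Dd : D (g a - g t) by rewrite -(scalerKV at1 (g a - g t)); exact: DZ.
  have Nd : N (g a - g t) <= (K + e) * `|a - t|.
    by rewrite -(scalerKV at1 (g a - g t)) NZ// mulrC ler_wpM2r.
  have gE : g t - g a = (-1) *: (g a - g t) by rewrite scaleN1r opprB.
  have Nd' : N (g t - g a) = N (g a - g t) by rewrite gE NZ// normrN1 mul1r.
  split=> ab.
    by split; [rewrite gE; exact: DZ|rewrite Nd' (le_trans Nd)// distrC ger0_norm// subr_ge0].
  by split=> //; rewrite (le_trans Nd)// ger0_norm// subr_ge0.
split; first by have [] := H 1 ltr01.
by apply/ler_addgt0Pr => e e0; have [_] := H e e0; rewrite subr0 mulr1.
Qed.

(** * Lipschitz and tame bounds on F from the tame bound on DF *)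

Section Differentiable.
Variables (R : realType) (S : R) (V W : banachScale S) (s0 m : R).
Variables (F : V -> W) (DF : V -> V -> W).
Hypotheses (s0_ge0 : 0 <= s0) (m_ge0 : 0 <= m).
Hypothesis F_diff : G_differentiable s0 m F DF.

Lemma sballW s s' r u : 0 <= s -> s <= s' -> s' <= S ->
  sball V s' r u -> sball V s r u.
Proof.
move=> ps ss' s'S [Hu Nu]; split; first exact: sspace_sub Hu.
exact: le_lt_trans (snorm_le _ _ _ Hu) Nu.
Qed.

Lemma G_differentiable_eps s u h (e : R) :
  s0 <= s -> s <= S - m -> sball V (s0 + m) 1 u ->
  sspace V (s + m) u -> sspace V (s + m) h -> 0 < e ->
  exists2 r, 0 < r & forall t, t != 0 -> `|t| < r ->
    sspace W s (t^-1 *: (F (u + t *: h) - F u)) /\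
    snorm W s (t^-1 *: (F (u + t *: h) - F u) - DF u h) < e.
Proof.
move=> s0s sS bu su sh e0.
have [_ _ /(_ s s0s sS su)[_ _ /(_ h sh)[near_in]]] := F_diff bu.
move=> /cvgrPdist_lt/(_ e e0) near_lt.
have [r /= r0 Hr] : \forall t \near 0^',
    sspace W s (t^-1 *: (F (u + t *: h) - F u)) /\
    snorm W s (t^-1 *: (F (u + t *: h) - F u) - DF u h) < e.
  near=> t; split; first by near: t.
  apply: le_lt_trans (ler_norm _) _; rewrite -normrN -sub0r.
  by near: t.
exists r => // t t0 tr; apply: Hr => //=.
by rewrite sub0r normrN.
Unshelve. all: by end_near. Qed.

Lemma sball_segment s r u v t : 0 <= s -> s <= S -> 0 <= t -> t <= 1 ->
  sball V s r u -> sball V s r v -> sball V s r (u + t *: (v - u)).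
Proof.
move=> p sS t0 t1 [su Nu] [sv Nv].
have -> : u + t *: (v - u) = (1 - t) *: u + t *: v.
  by rewrite scalerBr scalerBl scale1r addrA addrAC.
split; first by apply: sspace_lin => //; exact: sspaceZ.
apply: le_lt_trans (snormD _ _ _ _) _ => //; try exact: sspaceZ.
rewrite !snormZ// !ger0_norm// ?subr_ge0//.
have [t00|t00] := eqVneq t 0; first by rewrite t00 subr0 mul1r mul0r addr0.
have : t * snorm V s v < t * r by rewrite ltr_pM2l// lt_neqAle eq_sym t00.
have : (1 - t) * snorm V s u <= (1 - t) * r by rewrite ler_wpM2l ?subr_ge0// ltW.
by lra.
Qed.

Variable a : R.
Hypothesis a_gt0 : 0 < a.
Hypothesis DF_tame : forall s, s0 <= s -> s <= S - m ->
  forall u h, sball V (s0 + m) 1 u -> sspace V (s + m) u -> sspace V (s + m) h ->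
  sspace W s (DF u h) /\
  snorm W s (DF u h) <=
    a * (snorm V (s + m) h + snorm V (s + m) u * snorm V (s0 + m) h).

(** Regularity comes along with the bound: the difference quotients along the segment eventually lie
    in W_s, hence so does the whole increment. *)
Lemma increment_bound s u v (K : R) : s0 <= s -> s <= S - m ->
  sball V (s0 + m) 1 u -> sball V (s0 + m) 1 v ->
  sspace V (s + m) u -> sspace V (s + m) v ->
  (forall t, 0 <= t -> t <= 1 -> snorm W s (DF (u + t *: (v - u)) (v - u)) <= K) ->
  sspace W s (F v - F u) /\ snorm W s (F v - F u) <= K.
Proof.
move=> s0s sS bu bv su sv HK; move: s0_ge0 m_ge0 => ? ?.
have smS : s + m <= S by lra.
have sm0 : 0 <= s + m by lra.
have s_0 : 0 <= s by lra.
have s_S : s <= S by lra.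
have sh : sspace V (s + m) (v - u) by exact: sspaceB.
have := @mean_value R W (sspace W s) (snorm W s) (fun t => F (u + t *: (v - u))) K.
rewrite scale1r scale0r addr0 (addrC u) subrK; apply.
- exact: sspace_zero.
- by move=> *; exact: sspace_lin.
- by move=> *; exact: snormD.
- by move=> *; exact: snormZ.
- move=> t e t0 t1 e0.
  have bx : sball V (s0 + m) 1 (u + t *: (v - u)).
    by apply: sball_segment => //; lra.
  have sx : sspace V (s + m) (u + t *: (v - u)).
    by apply: sspaceD => //; exact: sspaceZ.
  have [r r0 Hr] := G_differentiable_eps s0s sS bx sx sh e0.
  exists r => // q q0 qr; have [Dq Nq] := Hr q q0 qr.
  rewrite scalerDl addrA; split=> //.
  have [DD _] := DF_tame s0s sS bx sx sh.
  rewrite -[X in snorm _ _ X](subrK (DF (u + t *: (v - u)) (v - u))).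
  apply: le_trans (snormD _ _ _ _) _ => //; first exact: sspaceB.
  by have := HK t t0 t1; lra.
Qed.

Lemma F_lipschitz u v : s0 <= S - m ->
  sball V (s0 + m) 1 u -> sball V (s0 + m) 1 v ->
  sspace W s0 (F v - F u) /\
  snorm W s0 (F v - F u) <= 2 * a * snorm V (s0 + m) (v - u).
Proof.
move=> s0S bu bv; move: s0_ge0 m_ge0 => ? ?.
apply: increment_bound => //; [by case: bu|by case: bv|].
move=> t t0 t1.
have s_0 : 0 <= s0 + m by lra.
have s_S : s0 + m <= S by lra.
have [bx Nx] : sball V (s0 + m) 1 (u + t *: (v - u)) by exact: sball_segment.
have sh : sspace V (s0 + m) (v - u) by case: bu bv => [? _] [? _]; exact: sspaceB.
have [_] := DF_tame (lexx _) s0S (conj bx Nx) bx sh.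
move=> /le_trans; apply; rewrite (mulrC 2) -mulrA ler_pM2l//.
have := snorm_ge0 s_0 s_S sh; rewrite mulr_natl mulr2n lerD2l => ?.
by rewrite ler_piMl// ltW.
Qed.

(** Integrate from 0 to [u]. On the unit ball the product term of the tame bound is at most the high
    norm of [u], so the estimate is linear in that norm, with factor 2. *)
Lemma F_tame s u : F 0 = 0 -> s0 <= s -> s <= S - m ->
  sball V (s0 + m) 1 u -> sspace V (s + m) u ->
  sspace W s (F u) /\ snorm W s (F u) <= 2 * a * snorm V (s + m) u.
Proof.
move=> F0 s0s sS bu su; move: s0_ge0 m_ge0 => ? ?.
have s_0 : 0 <= s + m by lra.
have s_S : s + m <= S by lra.
have t_0 : 0 <= s0 + m by lra.
have t_S : s0 + m <= S by lra.
rewrite -[F u]subr0 -F0.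
have z0 : sball V (s0 + m) 1 0.
  by split; [exact: sspace_zero|rewrite snorm_zero].
apply: increment_bound => //; first exact: sspace_zero.
move=> t t0 t1; rewrite subr0 add0r.
have bx : sball V (s0 + m) 1 (t *: u).
  by have := sball_segment t_0 t_S t0 t1 z0 bu; rewrite subr0 add0r.
have [_] := DF_tame s0s sS bx (sspaceZ s_0 s_S t su) su.
move=> /le_trans; apply; rewrite snormZ// ger0_norm//.
have := snorm_ge0 s_0 s_S su; have [u1 u2] := bu; have := snorm_ge0 t_0 t_S u1.
set X := snorm V (s + m) u; set Y := snorm V (s0 + m) u in u2 *.
move=> Y0 X0; rewrite (mulrC 2) -(mulrA a) ler_pM2l//.
have : t * X * Y <= X * 1.
  by apply: ler_pM => //; rewrite ?mulr_ge0// ?ler_piMl// ltW.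
by lra.
Qed.

End Differentiable.

(** * Smoothing estimates for the projections *)

Section TameScale.
Variables (R : realType) (S : R) (V : tameScale S).

Definition tame_bound (A : R) := 1 <= A /\
  forall s L : R, 0 <= s -> s <= S -> 1 <= L -> forall u, sspace V s u ->
    (forall t : R, 0 <= t -> t <= S ->
       snorm V t (proj V L u) <= A * L `^ (Num.max (t - s) 0) * snorm V s u) /\
    (forall t : R, 0 <= t -> t <= s ->
       snorm V t (u - proj V L u) <= A * L `^ (- (s - t)) * snorm V s u).

Lemma tame_bound_exists : exists A, tame_bound A.
Proof.
have [A1 [A2 [A11 A21 H]]] := proj_tame V.
exists (A1 + A2); split; first by lra.
move=> s L s_0 s_S L1 u su; have [H1 H2] := H s L s_0 s_S L1 u su.
split=> t t0 tS; [apply: le_trans (H1 t t0 tS) _|apply: le_trans (H2 t t0 tS) _].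
  by rewrite -!mulrA ler_wpM2r// ?mulr_ge0 ?powR_ge0 ?snorm_ge0// lerDl; lra.
by rewrite -!mulrA ler_wpM2r// ?mulr_ge0 ?powR_ge0 ?snorm_ge0// lerDr; lra.
Qed.

Lemma proj_idem (L : R) u : 1 <= L -> proj V L (proj V L u) = proj V L u.
Proof. by move=> L1; have [] := proj_comp L1 (lexx L) u. Qed.

Lemma proj_sspace (L : R) u s : 1 <= L -> 0 <= s -> s <= S -> sspace V s (proj V L u).
Proof.
move=> L1 s_0 sS; apply: (sspace_sub s_0 sS (lexx _)).
by apply: (proj_range L1); exists u.
Qed.

(** From here on membership in E(L) is expressed by the equation [proj V L u = u], equivalent by
    idempotence and easy to propagate by linearity. *)
Lemma fixed_sspace (L : R) u s : 1 <= L -> proj V L u = u -> 0 <= s -> s <= S ->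
  sspace V s u.
Proof. by move=> L1 <-; exact: proj_sspace. Qed.

Variable A : R.
Hypothesis HA : tame_bound A.

Lemma projS (s t L : R) u : 0 <= s -> s <= t -> t <= S -> 1 <= L -> sspace V s u ->
  snorm V t (proj V L u) <= A * L `^ (t - s) * snorm V s u.
Proof.
move=> s_0 st tS L1 su; have [_ /(_ s L s_0 (le_trans st tS) L1 u su)[H _]] := HA.
by have := H t (le_trans s_0 st) tS; rewrite max_l// subr_ge0.
Qed.

Lemma projW (s t L : R) u : 0 <= t -> t <= s -> s <= S -> 1 <= L -> sspace V s u ->
  snorm V t (proj V L u) <= A * snorm V s u.
Proof.
move=> t_0 ts sS L1 su; have [_ /(_ s L (le_trans t_0 ts) sS L1 u su)[H _]] := HA.
by have := H t t_0 (le_trans ts sS); rewrite max_r ?subr_le0// powRr0 mulr1.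
Qed.

Lemma projC (s t L : R) u : 0 <= t -> t <= s -> s <= S -> 1 <= L -> sspace V s u ->
  snorm V t (u - proj V L u) <= A * L `^ (- (s - t)) * snorm V s u.
Proof.
move=> t_0 ts sS L1 su; have [_ /(_ s L (le_trans t_0 ts) sS L1 u su)[_ H]] := HA.
exact: H.
Qed.

End TameScale.

Lemma linear_on_scale (R : realType) (V W : lmodType R) (D : set V) (f : V -> W)
    (a : R) u : linear_on D f -> D 0 -> D u -> f (a *: u) = a *: f u.
Proof.
move=> fl D0 Du; have f0 : f 0 = 0.
  have := fl 1 0 0 D0 D0; rewrite !scale1r addr0 => /eqP.
  by rewrite -subr_eq0 opprD addNKr oppr_eq0 => /eqP.
by have := fl a u 0 Du D0; rewrite f0 !addr0.
Qed.

(** * The Galerkin step *)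

Section GalerkinStep.
Variables (R : realType) (S : R) (V W : tameScale S) (s0 m l : R).
Variables (F : V -> W) (DF : V -> V -> W) (a A A' L M : R).
Let sg := s0 + Num.max m l.
Hypotheses (s0_ge0 : 0 <= s0) (m_ge0 : 0 <= m) (sg_leS : sg <= S).
Hypotheses (L_ge1 : 1 <= L) (M_ge1 : 1 <= M) (a_gt0 : 0 < a).
Hypotheses (HA : tame_bound V A) (HA' : tame_bound W A').
Hypothesis F_diff : G_differentiable s0 m F DF.
Hypothesis DF_tame : forall s, s0 <= s -> s <= S - m ->
  forall u h, sball V (s0 + m) 1 u -> sspace V (s + m) u -> sspace V (s + m) h ->
  sspace W s (DF u h) /\
  snorm W s (DF u h) <=
    a * (snorm V (s + m) h + snorm V (s + m) u * snorm V (s0 + m) h).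
Hypothesis F_galerkin : galerkin_continuous s0 m l DF L M.

Local Notation Pi := (proj V L).
Local Notation Pi' := (proj W M).

Let sgE : s0 + m <= sg. Proof. by rewrite /sg lerD2l le_max lexx. Qed.
Let s0_leS : s0 <= S.
Proof. by move: s0_ge0 m_ge0 sg_leS sgE; lra. Qed.
Let s0m_ge0 : 0 <= s0 + m. Proof. by move: s0_ge0 m_ge0; lra. Qed.
Let s0m_leS : s0 + m <= S. Proof. exact: le_trans sgE sg_leS. Qed.
Let sg_ge0 : 0 <= sg. Proof. exact: le_trans s0m_ge0 sgE. Qed.
Let s0_le_sg : s0 <= sg. Proof. by move: m_ge0 sgE; lra. Qed.
Let s0_leSm : s0 <= S - m. Proof. by move: s0m_leS; lra. Qed.

Lemma sball_sg_s0m u : sball V sg 1 u -> sball V (s0 + m) 1 u.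
Proof. by apply: sballW. Qed.

Lemma galerkin_direction u h (e : R) : sball V sg 1 u -> Pi u = u -> Pi h = h ->
  0 < e -> exists2 d, 0 < d & forall v, sball V sg 1 v -> Pi v = v ->
    snorm V s0 (v - u) < d -> snorm W s0 (Pi' (DF v h) - Pi' (DF u h)) <= e.
Proof.
move=> bu Pu Ph e0; set n := snorm V s0 h + 1.
have sh : sspace V s0 h by apply: fixed_sspace Ph _ _.
have shm : sspace V (s0 + m) h by apply: fixed_sspace Ph _ _.
have n0 : 0 < n by rewrite ltr_pwDr// snorm_ge0.
have rP x : Pi x = x -> range Pi x by move=> Px; exists x.
have [_ /(_ u (conj bu (rP _ Pu)) (e / n))] := F_galerkin.
rewrite divr_gt0// => /(_ isT)[d d0 Hd].
exists d => // v bv Pv vu.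
have := Hd v (conj bv (rP _ Pv)) vu.
pose T h : W := Pi' (DF v h) - Pi' (DF u h); rewrite -/T => Hsup.
have hn : range Pi (n^-1 *: h) /\ snorm V s0 (n^-1 *: h) <= 1.
  split; first by apply: rP; rewrite linearZ/= Ph.
  by rewrite snormZ// ger0_norm ?invr_ge0 ?(ltW n0)// mulrC ler_pdivrMr// mul1r lerDl.
have : ((snorm W s0 (T (n^-1 *: h)))%:E <= opnorm (W := W) s0 (range Pi) T)%E.
  by apply: ereal_sup_ubound; exists (n^-1 *: h).
move=> /le_lt_trans/(_ Hsup); rewrite lte_fin /T.
have [linv DFv _] := F_diff (sball_sg_s0m bv).
have [linu DFu _] := F_diff (sball_sg_s0m bu).
have z := sspace_zero V s0m_ge0 s0m_leS.
rewrite (linear_on_scale _ linv)// (linear_on_scale _ linu)// !linearZ/= -scalerDr.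
rewrite snormZ//; last by apply: sspaceB => //; exact: proj_sspace.
by rewrite ger0_norm ?invr_ge0 ?(ltW n0)// mulrC ltr_pM2r ?invr_gt0// => /ltW.
Qed.

(** Gateaux differentiability alone gives no uniformity in the base point. Continuity of the
    projected derivative on E(L) supplies it: the mean value inequality, applied to F minus the
    linear map frozen at [u0] in the seminorm of the projected vector, yields a first-order
    expansion uniform in [u] near [u0]. *)
Lemma galerkin_increment u0 h (e : R) : sball V sg 1 u0 -> Pi u0 = u0 -> Pi h = h ->
  0 < e -> exists2 r, 0 < r & forall u t, Pi u = u -> snorm V s0 (u - u0) < r ->
    0 <= t -> t < r ->
    snorm W s0 (Pi' (F (u + t *: h) - F u) - t *: Pi' (DF u0 h)) <= t * e.
Proof.
move=> bu0 Pu0 Ph e0.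
have [d d0 Hd] := galerkin_direction bu0 Pu0 Ph e0.
have sE x s : Pi x = x -> 0 <= s -> s <= S -> sspace V s x.
  by move=> Px; apply: fixed_sspace Px.
have sh0 := sE h s0 Ph s0_ge0 s0_leS.
have shm := sE h (s0 + m) Ph s0m_ge0 s0m_leS.
(* On the range of [Pi] the norms of indices [s0] and [sg] are equivalent, with this constant. *)
pose K := A * L `^ (sg - s0).
have A1 : 1 <= A by case: HA.
have A'1 : 1 <= A' by case: HA'.
have K0 : 0 < K by rewrite mulr_gt0 ?powR_gt0//; move: A1 L_ge1; lra.
have HK x : Pi x = x -> snorm V sg x <= K * snorm V s0 x.
  by move=> Px; rewrite -{1}Px; apply: (projS HA) => //; exact: sE.
pose n := 1 + snorm V s0 h.
have n0 : 0 < n by rewrite ltr_pwDl// snorm_ge0.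
have nu0 : 0 < 1 - snorm V sg u0 by rewrite subr_gt0; case: bu0.
(* With this r, moving from [u0] to [u] and then by t h covers less than r n in norm [s0], which
   keeps the segment both within d of [u0] and inside the unit ball of index [sg]. *)
pose r := Num.min d ((1 - snorm V sg u0) / K) / n.
exists r; first by rewrite divr_gt0// lt_min d0 divr_gt0.
move=> u t Pu uu0 t0 tr.
have Hx q : 0 <= q -> q <= 1 -> let x := u + q *: (t *: h) in
    [/\ Pi x = x, sball V sg 1 x & snorm V s0 (x - u0) < d].
  move=> q0 q1 x; have Px : Pi x = x by rewrite /x linearD linearZ/= linearZ/= Pu Ph.
  have Pxu : Pi (x - u0) = x - u0 by rewrite linearB/= Px Pu0.
  have xu : snorm V s0 (x - u0) < Num.min d ((1 - snorm V sg u0) / K).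
    have -> : x - u0 = (u - u0) + (q * t) *: h by rewrite /x scalerA addrAC.
    apply: le_lt_trans (snormD _ _ _ _) _ => //.
    - by apply: sspaceB => //; [exact: sE Pu _ _|exact: sE Pu0 _ _].
    - exact: sspaceZ.
    rewrite snormZ// ger0_norm ?mulr_ge0//.
    have -> : Num.min d ((1 - snorm V sg u0) / K) = r + r * snorm V s0 h.
      by rewrite -{1}[r]mulr1 -mulrDr -/n divfK// gt_eqF.
    apply: ltr_leD => //; apply: ler_wpM2r; first exact: snorm_ge0.
    by apply: le_trans (ltW tr); rewrite ler_piMl.
  split=> //; last by apply: lt_le_trans xu _; rewrite ge_min lexx.
  split; first exact: sE.
  rewrite -[x](subrK u0); apply: le_lt_trans (snormD _ _ _ _) _ => //; try exact: sE.
  rewrite -ltrBrDr; apply: le_lt_trans (HK _ Pxu) _.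
  rewrite mulrC -ltr_pdivlMr//; apply: lt_le_trans xu _.
  by rewrite ge_min lexx orbT.
have bm q : 0 <= q -> q <= 1 -> sball V (s0 + m) 1 (u + q *: (t *: h)).
  by move=> q0 q1; have [_ bx _] := Hx q q0 q1; exact: sball_sg_s0m.
have [lin0 DF0 _] := F_diff (sball_sg_s0m bu0).
pose g q := F (u + q *: (t *: h)) - q *: (t *: DF u0 h).
have := @mean_value R W (sspace W s0) (fun w => snorm W s0 (Pi' w)) g (t * e).
have -> : Pi' (g 1 - g 0) = Pi' (F (u + t *: h) - F u) - t *: Pi' (DF u0 h).
  rewrite /g !scale1r !scale0r addr0 subr0 -linearZ -linearB/=; congr (Pi' _).
  by rewrite addrAC.
case=> //.
- exact: sspace_zero.
- by move=> *; exact: sspace_lin.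
- by move=> x y sx sy; rewrite linearD; apply: snormD => //; exact: proj_sspace.
- by move=> c x sx; rewrite linearZ/= snormZ//; exact: proj_sspace.
move=> q f q0 q1 f0; have [Px bx xd] := Hx q q0 q1.
set x := u + q *: (t *: h) in Px bx xd.
have bxm := sball_sg_s0m bx.
have sth : sspace V (s0 + m) (t *: h) by exact: sspaceZ.
have fA : 0 < f / A' by rewrite divr_gt0//; move: A'1; lra.
have [z z0 Hz] := G_differentiable_eps F_diff (lexx s0) s0_leSm bxm bxm.1 sth fA.
exists z => // s sn0 sz; have [Dq Nq] := Hz s sn0 sz.
have [linx DFx _] := F_diff bxm.
have xs : u + (q + s) *: (t *: h) = x + s *: (t *: h) by rewrite scalerDl addrA.
have -> : s^-1 *: (g (q + s) - g q) =
    (s^-1 *: (F (x + s *: (t *: h)) - F x) - DF x (t *: h)) + t *: (DF x h - DF u0 h).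
  rewrite /g xs -/x (linear_on_scale _ linx)//; last exact: sspace_zero.
  rewrite (scalerBr t) addrA subrK; set X := F _; set Y := F _; set k := t *: DF u0 h.
  have -> : X - (q + s) *: k - (Y - q *: k) = X - Y - s *: k.
    by rewrite scalerDl opprB [_ - Y]addrC addrACA opprD [_ + q *: k]addrAC addNr add0r.
  by rewrite [in LHS]scalerBr scalerA mulVf// scale1r.
have s1 : sspace W s0 (DF x h - DF u0 h) by apply: sspaceB => //; [exact: DFx|exact: DF0].
have s2 : sspace W s0 (s^-1 *: (F (x + s *: (t *: h)) - F x) - DF x (t *: h)).
  by apply: sspaceB => //; exact: DFx.
split; first by apply: sspaceD => //; exact: sspaceZ.
rewrite linearD; apply: le_trans (snormD _ _ _ _) _ => //; try exact: proj_sspace.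
rewrite addrC; apply: lerD.
  rewrite linearZ/= snormZ//; last exact: proj_sspace.
  by rewrite ger0_norm// ler_wpM2l// linearB; exact: Hd.
apply: le_trans (projW HA' s0_ge0 (lexx _) s0_leS M_ge1 s2) _.
by rewrite mulrC -ler_pdivlMr; [exact: ltW|move: A'1; lra].
Qed.

(** The quantitative result involves only [C]. The constants [K] and [K'], which will depend badly
    on the frequencies, serve for continuity and completeness alone. [Om] is the region where an
    approximate right inverse is available. *)
Variables (N : V -> R) (N' : W -> R) (C K K' : R) (Om : set V).
Hypothesis C_gt0 : 0 < C.
Hypotheses (ND : forall u v, N (u + v) <= N u + N v)
  (NZ : forall (c : R) u, N (c *: u) = `|c| * N u)
  (N'D : forall u v, N' (u + v) <= N' u + N' v)
  (N'Z : forall (c : R) u, N' (c *: u) = `|c| * N' u).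
Hypotheses (K_gt0 : 0 < K) (K'_gt0 : 0 < K').
Hypothesis N_ge : forall u, Pi u = u -> snorm V sg u <= K * N u.
Hypothesis N_le : forall u, Pi u = u -> N u <= K * snorm V s0 u.
Hypothesis N'_le : forall k, sspace W s0 k -> N' (Pi' k) <= K' * snorm W s0 k.
Hypothesis N'_eq0 : forall k, Pi' k = k -> N' k = 0 -> k = 0.
Hypothesis Om_ball : forall u, Om u -> Pi u = u -> sball V sg 1 u.
Hypothesis Om_right_inverse : forall u k, Om u -> Pi u = u -> Pi' k = k ->
  exists h, [/\ Pi h = h, N h <= C * N' k & N' (Pi' (DF u h) - k) <= N' k / 2].

Variables (B : normedModType R) (P : set B) (g : B -> V) (w : B -> W).
Hypothesis g_in : forall b, P b -> Pi (g b) = g b.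
Hypothesis w_in : forall b, P b -> Pi' (w b) = w b.
Hypothesis g_cont : forall b, P b -> forall e : R, 0 < e -> exists2 r, 0 < r &
  forall b', P b' -> `|b - b'| < r -> N (g b - g b') < e.
Hypothesis w_cont : forall b, P b -> forall e : R, 0 < e -> exists2 r, 0 < r &
  forall b', P b' -> `|b - b'| < r -> N' (w b - w b') < e.
Hypothesis Om_near : forall b u, P b -> Pi u = u ->
  N (u - g b) <= 4 * C * N' (Pi' (F (g b)) - w b) -> Om u.

(* The potential is the residual, measured so that moving by N h decreases it
   by at least N h. *)
Lemma galerkin_step : exists g' : B -> V,
  [/\ forall b, P b -> Pi (g' b) = g' b,
      forall b, P b -> Pi' (F (g' b)) = w b,
      forall b, P b -> N (g' b - g b) <= 4 * C * N' (Pi' (F (g b)) - w b) &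
      forall b, P b -> forall e : R, 0 < e -> exists2 r, 0 < r &
        forall b', P b' -> `|b - b'| < r -> N (g' b - g' b') < e].
Proof.
have N0 : N 0 = 0 by rewrite -(scale0r 0) NZ normr0 mul0r.
have NN u : N (- u) = N u by rewrite -scaleN1r NZ normrN1 mul1r.
have NB u v : N (u - v) = N (v - u) by rewrite -NN opprB.
have N_ge0 u : 0 <= N u by have := ND u (- u); rewrite NN subrr N0; lra.
have N'0 : N' 0 = 0 by rewrite -(scale0r 0) N'Z normr0 mul0r.
have N'N u : N' (- u) = N' u by rewrite -scaleN1r N'Z normrN1 mul1r.
have N'B u v : N' (u - v) = N' (v - u) by rewrite -N'N opprB.
have N'_ge0 u : 0 <= N' u by have := N'D u (- u); rewrite N'N subrr N'0; lra.
pose res (z : B * V) := N' (Pi' (F z.2) - w z.1).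
(* The factor 4: with [ka] the residual at the centre, a motion by s h lowers the residual by s ka
   (1 - 1/2 - 1/8 - 1/16 - 1/16) = s ka / 4. The losses come from the approximate inverse, from the
   remainder of the expansion, and twice from using the residual of the centre instead of that of
   y. *)
pose phi z := 4 * C * res z.
pose d (x y : B * V) := `|x.1 - y.1| + N (x.2 - y.2).
(* The last condition is Caristi's order relation to the starting point. Motions preserve it, and
   through [Om_near] it confines [z.2] to [Om]. *)
pose D := [set z : B * V | [/\ P z.1, Pi z.2 = z.2 &
  N (z.2 - g z.1) + phi z <= phi (z.1, g z.1)]].
have C4 : 0 < 4 * C by rewrite mulr_gt0.
have phi_ge0 z : 0 <= phi z by apply: mulr_ge0; [exact: ltW|exact: N'_ge0].
have d_refl z : d z z = 0 by rewrite /d !subrr normr0 N0 addr0.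
have d_sym x y : d x y = d y x by rewrite /d distrC NB.
have d_tri x y z : d x z <= d x y + d y z.
  rewrite /d addrACA; apply: lerD; first exact: ler_distD.
  by have := ND (x.2 - y.2) (y.2 - z.2); rewrite addrA subrK.
have DOm z : D z -> Om z.2 /\ sball V sg 1 z.2.
  move=> [Pz Ez Hz]; have Oz : Om z.2.
    apply: (Om_near Pz Ez); apply: le_trans Hz.
    by rewrite lerDl.
  by split=> //; exact: Om_ball.
have Nm u : Pi u = u -> snorm V (s0 + m) u <= K * N u.
  move=> Pu; apply: le_trans (N_ge Pu); apply: snorm_le => //.
  exact: fixed_sspace Pu _ _.
have Ns u : Pi u = u -> snorm V s0 u <= K * N u.
  move=> Pu; apply: le_trans (N_ge Pu); apply: snorm_le => //.
  exact: fixed_sspace Pu _ _.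
have res_lip z z' : sball V sg 1 z.2 -> sball V sg 1 z'.2 -> Pi z.2 = z.2 ->
    Pi z'.2 = z'.2 ->
    N' (Pi' (F z.2) - w z.1 - (Pi' (F z'.2) - w z'.1)) <=
      K' * (2 * a * (K * N (z.2 - z'.2))) + N' (w z.1 - w z'.1).
  move=> bz bz' Ez Ez'.
  have -> : Pi' (F z.2) - w z.1 - (Pi' (F z'.2) - w z'.1) =
      Pi' (F z.2 - F z'.2) + (w z'.1 - w z.1).
    by rewrite [Pi' (_ - _)]linearB/= opprB [LHS]addrACA [RHS]addrACA
               [- w z.1 + _]addrC.
  apply: le_trans (N'D _ _) _; rewrite (N'B (w z'.1)) lerD2r.
  have [sF NF] := F_lipschitz s0_ge0 m_ge0 F_diff a_gt0 DF_tame s0_leSm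
    (sball_sg_s0m bz') (sball_sg_s0m bz).
  apply: le_trans (N'_le sF) _; rewrite ler_pM2l//; apply: le_trans NF _.
  rewrite ler_pM2l ?mulr_gt0//; apply: Nm; by rewrite linearB/= Ez Ez'.
have res_cont z (e : R) : P z.1 -> sball V sg 1 z.2 -> Pi z.2 = z.2 -> 0 < e ->
    exists2 r, 0 < r & forall z', P z'.1 -> sball V sg 1 z'.2 -> Pi z'.2 = z'.2 ->
      d z z' < r -> N' (Pi' (F z.2) - w z.1 - (Pi' (F z'.2) - w z'.1)) < e.
  move=> Pz bz Ez e0; have e20 : 0 < e / 2 by rewrite divr_gt0.
  have [r r0 Hr] := w_cont Pz e20.
  pose k := K' * (2 * a * K).
  have k0 : 0 < k by rewrite !mulr_gt0.
  exists (Num.min r (e / 2 / k)); first by rewrite lt_min r0 divr_gt0.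
  move=> z' Pz' bz' Ez'; rewrite lt_min => /andP[d1 d2].
  apply: le_lt_trans (res_lip _ _ bz bz' Ez Ez') _.
  have : N' (w z.1 - w z'.1) < e / 2.
    by apply: Hr => //; apply: le_lt_trans d1; rewrite lerDl.
  have : N (z.2 - z'.2) < e / 2 / k by apply: le_lt_trans d2; rewrite lerDr.
  rewrite ltr_pdivlMr// => h1.
  have -> : K' * (2 * a * (K * N (z.2 - z'.2))) = N (z.2 - z'.2) * k by rewrite /k; ring.
  by move: h1; lra.
have phi_cont z (e : R) : P z.1 -> sball V sg 1 z.2 -> Pi z.2 = z.2 -> 0 < e ->
    exists2 r, 0 < r & forall z', P z'.1 -> sball V sg 1 z'.2 -> Pi z'.2 = z'.2 ->
      d z z' < r -> `|phi z - phi z'| < e.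
  move=> Pz bz Ez e0; have eC : 0 < e / (4 * C) by rewrite divr_gt0.
  have [r r0 Hr] := res_cont z _ Pz bz Ez eC; exists r => // z' Pz' bz' Ez' zz'.
  have := Hr z' Pz' bz' Ez' zz'; rewrite ltr_pdivlMr//.
  apply: le_lt_trans; rewrite -mulrBr normrM (gtr0_norm C4) mulrC.
  apply: ler_wpM2r; first exact: ltW.
  rewrite /res; set X := _ - w z.1; set Y := _ - w z'.1.
  have := N'D (X - Y) Y; have := N'D (Y - X) X; rewrite !subrK (N'B Y X) ler_norml.
  by move=> ? ?; apply/andP; split; lra.
have phic x : D x -> forall e : R, 0 < e -> exists2 r : R, 0 < r &
    forall y, D y -> d x y < r -> `|phi x - phi y| < e.
  move=> Dx e e0; have [_ bx] := DOm x Dx; case: (Dx) => Px Ex _.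
  have [r r0 Hr] := phi_cont x e Px bx Ex e0; exists r => // y Dy xy.
  by have [_ yb] := DOm y Dy; case: (Dy) => Py Ey _; exact: Hr.
have moves x : D x -> 0 < phi x ->
    exists e k h, is_local_move d fst D phi x e k h.
  move=> Dx px; have [Ox bx] := DOm x Dx; case: (Dx) => Px Ex _.
  pose k0 := w x.1 - Pi' (F x.2).
  have Ek0 : Pi' k0 = k0 by rewrite linearB/= w_in// proj_idem.
  (* The direction is computed at the centre x only and reused for all nearby y, so the way it
     depends on the base point never matters. *)
  have [h [Eh Nh N'h]] := Om_right_inverse Ox Ex Ek0.
  set ka := N' k0 in Nh N'h.
  have ka0 : 0 < ka by rewrite /ka N'B; move: px; rewrite /phi pmulr_rgt0.
  have ka80 : 0 < ka / 8 / K' by rewrite !divr_gt0.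
  have [r r0 Hr] := galerkin_increment bx Ex Eh ka80.
  have ka160 : 0 < ka / 16 by rewrite divr_gt0.
  have [r1 r10 Hr1] := res_cont x _ Px bx Ex ka160.
  pose t0 := Num.min 1 (r / 2).
  have t00 : 0 < t0 by rewrite lt_min ltr01 divr_gt0.
  have t01 : t0 <= 1 by rewrite ge_min lexx.
  have t0r : t0 < r.
    by apply: (@le_lt_trans _ _ (r / 2)); [rewrite ge_min lexx orbT|lra].
  exists (Num.min r1 (r / K)), (t0 * N h), (fun t y => (y.1, y.2 + (t * t0) *: h)).
  split.
  - by rewrite lt_min r10 divr_gt0.
  - by move=> [b u] /=; rewrite mul0r scale0r addr0.
  - move=> y y' t t'; rewrite /d /= -[leRHS]addrA lerD2l opprD addrACA -scalerBl.
    apply: le_trans (ND _ _) _; rewrite lerD2l NZ -mulrBl normrM (gtr0_norm t00).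
    by rewrite mulrC (mulrC `|_|) mulrA (mulrC _ t0).
  - move=> y t Dy; rewrite lt_min => /andP[d1 d2] tt0 tt1.
    have [Oy yb] := DOm y Dy; case: (Dy) => Py Ey Hy.
    pose s := t * t0.
    have s_0 : 0 <= s by rewrite mulr_ge0// ltW.
    have s_1 : s <= 1 by rewrite mulr_ile1// ltW.
    have sr : s < r by apply: le_lt_trans t0r; rewrite ler_piMl// ltW.
    have near_s0 : snorm V s0 (y.2 - x.2) < r.
      apply: le_lt_trans (Ns _ _) _; first by rewrite linearB/= Ey Ex.
      rewrite mulrC -ltr_pdivlMr// NB; apply: le_lt_trans d2.
      by rewrite lerDr.
    have rem := Hr y.2 s Ey near_s0 s_0 sr.
    have kk := Hr1 y Py yb Ey d1.
    pose e1 := Pi' (F (y.2 + s *: h) - F y.2) - s *: Pi' (DF x.2 h).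
    have Ne1 : N' e1 <= s * (ka / 8).
      have Ee1 : Pi' e1 = e1.
        by rewrite /e1 linearB linearZ/= !proj_idem.
      have se1 : sspace W s0 e1 by apply: fixed_sspace Ee1 _ _.
      rewrite -Ee1; apply: le_trans (N'_le se1) _.
      apply: (@le_trans _ _ (K' * (s * (ka / 8 / K')))); first by rewrite ler_pM2l.
      by rewrite mulrCA (mulrC K') divfK// gt_eqF.
    pose ky := Pi' (F y.2) - w y.1.
    have newE : Pi' (F (y.2 + s *: h)) - w y.1 =
        (1 - s) *: ky + s *: (ky + k0) + (s *: (Pi' (DF x.2 h) - k0) + e1).
      have alg (k1 k2 : W) : (1 - s) *: k1 + s *: (k1 + k2) = k1 + s *: k2.
        by rewrite scalerBl scale1r scalerDr addrA subrK.
      have -> : s *: (Pi' (DF x.2 h) - k0) + e1 =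
          Pi' (F (y.2 + s *: h)) - Pi' (F y.2) - s *: k0.
        by rewrite /e1 [Pi' (_ - _)]linearB [s *: (_ - _)]scalerBr addrC addrA subrK.
      rewrite alg.
      by rewrite addrACA subrr addr0 addrC addrA subrK.
    have kyk0 : N' (ky + k0) <= ka / 16.
      by rewrite -[k0]opprB N'B ltW.
    have kyka : ka <= N' ky + ka / 16.
      have := N'D (ky + k0) (- ky); rewrite [ky + k0 - ky]addrC addKr N'N.
      by rewrite -/ka; lra.
    have newle : N' (Pi' (F (y.2 + s *: h)) - w y.1) <= N' ky - s * (ka / 4).
      rewrite newE; apply: le_trans (N'D _ _) _.
      have h1 := N'D ((1 - s) *: ky) (s *: (ky + k0)).
      have h2 := N'D (s *: (Pi' (DF x.2 h) - k0)) e1.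
      rewrite !N'Z !(ger0_norm s_0) (ger0_norm (_ : 0 <= 1 - s)) ?subr_ge0// in h1 h2.
      have h3 : s * N' (ky + k0) <= s * (ka / 16) by rewrite ler_wpM2l.
      have h4 : s * N' (Pi' (DF x.2 h) - k0) <= s * (ka / 2) by rewrite ler_wpM2l.
      have h5 : s * ka <= s * (N' ky + ka / 16) by rewrite ler_wpM2l.
      by move: h1 h2 h3 h4 h5 Ne1; lra.
    have Nsh : s * N h <= C * (s * ka).
      by rewrite mulrCA ler_wpM2l.
    have philt : phi (y.1, y.2 + s *: h) <= phi y - C * (s * ka).
      have -> : phi y - C * (s * ka) = 4 * C * (N' ky - s * (ka / 4)).
        by rewrite /phi /res -/ky; field.
      by rewrite ler_pM2l.
    rewrite -/s; split=> //.
    + split=> //=; first by rewrite linearD linearZ/= Ey Eh.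
      apply: le_trans Hy; rewrite addrAC.
      have := ND (y.2 - g y.1) (s *: h); rewrite NZ ger0_norm//.
      by move: philt Nsh; lra.
    + rewrite /d /= subrr normr0 add0r opprD addNKr NN NZ ger0_norm//.
      by move: philt Nsh; lra.
    + move=> t_gt0; apply: le_lt_trans philt _.
      by rewrite gtrBl !mulr_gt0.
(* The parameter is constant along the sequence, so only the second components have to converge:
   they do so in V_s0, and applying [Pi] to the limit brings it back to E(L). *)
have complete x : (forall k, D (x k)) -> (forall k, (x k).1 = (x 0%N).1) ->
    cauchy_in d x -> exists a, [/\ D a, a.1 = (x 0%N).1 & converges_to d x a].
  move=> Dx x1 xc; pose u k := (x k).2.
  have Eu k : Pi (u k) = u k by case: (Dx k).
  have su k : sspace V s0 (u k) by apply: fixed_sspace (Eu k) _ _.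
  have cu (e : R) : 0 < e -> exists n, forall i j, (n <= i)%N -> (n <= j)%N ->
      snorm V s0 (u i - u j) < e.
    move=> e0; have [n Hn] := xc (e / K) (divr_gt0 e0 K_gt0); exists n => i j ni nj.
    have := Hn i j ni nj; rewrite /d => Hd.
    apply: le_lt_trans (Ns _ _) _; first by rewrite linearB/= !Eu.
    rewrite mulrC -ltr_pdivlMr//; apply: le_lt_trans Hd.
    by rewrite lerDr.
  have [c sc Hc] := snorm_complete s0_ge0 s0_leS su cu.
  pose cl := Pi c.
  have Ecl : Pi cl = cl by rewrite proj_idem.
  have A0 : 0 < A by case: HA; lra.
  have ucl (e : R) : 0 < e -> exists n, forall i, (n <= i)%N -> N (u i - cl) < e.
    move=> e0; have [|n Hn] := Hc (e / (K * A)); first by rewrite divr_gt0// mulr_gt0.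
    exists n => i ni; apply: le_lt_trans (N_le _) _; first by rewrite linearB/= Eu Ecl.
    have := Hn i ni; rewrite ltr_pdivlMr ?mulr_gt0//; apply: le_lt_trans.
    rewrite [leRHS]mulrC -[leRHS]mulrA ler_pM2l// -{1}[u i]Eu -linearB.
    by apply: (projW HA) => //; exact: sspaceB.
  pose b := (x 0%N).1; have Pb : P b by case: (Dx 0%N).
  have Ncl : N (cl - g b) <= phi (b, g b).
    apply/ler_addgt0Pr => e e0; have [n Hn] := ucl e e0.
    have [_ _ ] := Dx n; rewrite x1 -/b -/(u n) => Hx.
    have := Hn n (leqnn n); rewrite NB => Hn'.
    have := ND (cl - u n) (u n - g b); rewrite addrA subrK.
    by have := phi_ge0 (x n); lra.
  have Ocl : Om cl by apply: (Om_near Pb Ecl).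
  have bcl := Om_ball Ocl Ecl.
  have dx (e : R) : 0 < e -> exists n, forall i, (n <= i)%N -> d (x i) (b, cl) < e.
    move=> e0; have [n Hn] := ucl e e0; exists n => i ni.
    by rewrite /d x1 subrr normr0 add0r; exact: Hn.
  exists (b, cl); split=> //; split=> //=.
  apply/ler_addgt0Pr => e e0; have e20 : 0 < e / 2 by rewrite divr_gt0.
  have [r r0 Hr] := phi_cont (b, cl) _ Pb bcl Ecl e20.
  have [n1 Hn1] := dx r r0; have [n2 Hn2] := ucl _ e20.
  pose n := (n1 + n2)%N; have := Hn1 n (leq_addr _ _); rewrite d_sym => Hd.
  have [_ bn] := DOm _ (Dx n); have [Pn En Hxn] := Dx n.
  have := Hr _ Pn bn En Hd; have := Hn2 n (leq_addl _ _); rewrite NB => h1.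
  rewrite ltr_norml => /andP[h2 h3].
  have := ND (cl - u n) (u n - g b); rewrite addrA subrK.
  by move: Hxn; rewrite x1 -/b -/(u n); lra.
have [rho [Hrho rhoc]] := @continuous_caristi R (B * V)%type d d_refl d_sym d_tri
  B fst D phi phic moves (fun x _ => phi_ge0 x) complete.
have Dg b : P b -> D (b, g b).
  by move=> Pb; split=> //=; [exact: g_in|rewrite subrr N0 add0r].
exists (fun b => (rho (b, g b)).2); split.
- by move=> b /Dg/Hrho[[]].
- move=> b Pb; have [[_ E _] r1 p0 _] := Hrho _ (Dg b Pb).
  apply/eqP; rewrite -subr_eq0; apply/eqP; apply: N'_eq0.
    by rewrite linearB/= proj_idem// w_in.
  apply/eqP; move/eqP: p0; rewrite /phi mulf_eq0 gt_eqF//= /res r1.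
  exact.
- move=> b Pb; have [[_ E _] r1 p0] := Hrho _ (Dg b Pb).
  rewrite NB; apply: le_trans; by rewrite lerDr.
- move=> b Pb e e0; have [r r0 Hr] := rhoc _ (Dg b Pb) e e0.
  have r20 : 0 < r / 2 by rewrite divr_gt0.
  have [r' r'0 Hr'] := g_cont Pb r20.
  exists (Num.min r' (r / 2)); first by rewrite lt_min r'0.
  move=> b' Pb'; rewrite lt_min => /andP[b1 b2].
  have : d (b, g b) (b', g b') < r.
    by rewrite /d /=; have := Hr' b' Pb' b1; lra.
  move=> /(Hr _ (Dg b' Pb')); apply: le_lt_trans.
  by rewrite /d lerDr.
Qed.

End GalerkinStep.

(** * Two-level weighted norms *)

Lemma powR_add (R : realType) (L x y : R) : 1 <= L -> L `^ x * L `^ y = L `^ (x + y).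
Proof.
by move=> L1; rewrite powRD// (gt_eqF (lt_le_trans ltr01 L1)) implybT.
Qed.

Section WeightedNorm.
Variables (R : realType) (S : R) (V : tameScale S) (L p q s t c : R).
Hypotheses (s_ge0 : 0 <= s) (s_le_t : s <= t) (t_leS : t <= S) (L_ge1 : 1 <= L)
  (p_gt0 : 0 < p) (q_gt0 : 0 < q) (Hc : tame_bound V c).

(** Projecting first gives a seminorm defined on all of [V] without membership conditions, as
    [galerkin_step] requires; on E(L) it is the weighted norm itself. It vanishes on the kernel of
    the projection, whence the pseudometric setting of the Caristi argument. *)
Definition wnorm (u : V) := snorm V s (proj V L u) / p + snorm V t (proj V L u) / q.

Let s_leS : s <= S. Proof. exact: le_trans s_le_t t_leS. Qed.
Let t_ge0 : 0 <= t. Proof. exact: le_trans s_ge0 s_le_t. Qed.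
Let Ps u : sspace V s (proj V L u). Proof. exact: proj_sspace. Qed.
Let Pt u : sspace V t (proj V L u). Proof. exact: proj_sspace. Qed.

Lemma wnormD u v : wnorm (u + v) <= wnorm u + wnorm v.
Proof.
rewrite /wnorm linearD addrACA -!mulrDl.
by apply: lerD; rewrite ler_pM2r ?invr_gt0//; apply: snormD.
Qed.

Lemma wnormZ (a : R) u : wnorm (a *: u) = `|a| * wnorm u.
Proof. by rewrite /wnorm linearZ/= !snormZ// mulrDr !mulrA. Qed.

Lemma wnorm_fst u : proj V L u = u -> snorm V s u <= p * wnorm u.
Proof.
move=> Pu; rewrite /wnorm Pu mulrDr mulrCA mulfV ?gt_eqF// mulr1 lerDl.
apply: mulr_ge0; first exact: ltW.
by apply: divr_ge0 (ltW _) => //; rewrite -Pu; exact: snorm_ge0.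
Qed.

Lemma wnorm_snd u : proj V L u = u -> snorm V t u <= q * wnorm u.
Proof.
move=> Pu; rewrite /wnorm Pu mulrDr [q * (_ / q)]mulrCA mulfV ?gt_eqF// mulr1 lerDr.
apply: mulr_ge0; first exact: ltW.
by apply: divr_ge0 (ltW _) => //; rewrite -Pu; exact: snorm_ge0.
Qed.

Lemma wnorm_le u (x y : R) : proj V L u = u -> snorm V s u <= p * x ->
  snorm V t u <= q * y -> wnorm u <= x + y.
Proof.
by move=> Pu hx hy; rewrite /wnorm Pu; apply: lerD; rewrite ler_pdivrMr// mulrC.
Qed.

(** The constant depends on L, p and q, so this is of topological use only. *)
Lemma wnorm_equiv s' : 0 <= s' -> s' <= s -> exists2 K : R, 0 < K &
  forall u, sspace V s' u -> wnorm (proj V L u) <= K * snorm V s' u.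
Proof.
move=> s'0 s's; have c1 : 1 <= c by case: Hc.
have c0 : 0 < c by apply: lt_le_trans c1.
have L0 x : 0 < L `^ x by rewrite powR_gt0// (lt_le_trans ltr01).
exists (c * L `^ (s - s') / p + c * L `^ (t - s') / q).
  by rewrite addr_gt0// divr_gt0// mulr_gt0.
move=> u su; rewrite /wnorm proj_idem// mulrDl.
apply: lerD; rewrite ler_pdivrMr// mulrAC divfK ?gt_eqF//.
  exact: (projS Hc).
by apply: (projS Hc) => //; exact: le_trans s_le_t.
Qed.

End WeightedNorm.

(** * The truncated right inverse, bounded uniformly in the frequency *)

Lemma index_bounds (R : realType) (s0 m l l' kap tau S : R) :
  0 <= s0 -> 0 <= m -> 0 <= l -> 0 <= l' -> 0 <= kap -> s0 + m + kap <= tau ->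
  tau + l <= S -> tau + l' <= S ->
  [/\ [/\ 0 <= s0 + l', s0 + l' <= S, 0 <= tau + l' & s0 + l' <= tau + l'],
      [/\ 0 <= tau, tau <= S, s0 <= tau, s0 <= S & s0 <= S - m],
      [/\ 0 <= s0 + m, s0 + m <= tau, s0 + m <= S, 0 <= tau - kap & tau - kap <= tau] &
      [/\ [/\ tau - kap <= S, s0 <= tau - m - kap & tau - m - kap <= S - m],
          [/\ 0 <= tau - m - kap, tau - m - kap <= tau + l', 0 <= s0 + l & s0 + l <= S] &
          [/\ 0 <= tau + l, tau <= tau + l & s0 <= s0 + l']]].
Proof. by move=> *; do !split; lra. Qed.

Section ApproximateInverse.
Variables (R : realType) (S : R) (V W : tameScale S) (s0 m l l' : R).
Variables (DF : V -> V -> W) (Lu : W -> V) (u : V).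
Variables (c L y B beta tau kap eps : R).
Let sg := s0 + Num.max m l.
Local Notation M := (L `^ y).
Local Notation Pi := (proj V L).
Local Notation Pi' := (proj W M).
Let p := L `^ (- B - eps).
Let q := L `^ (beta - eps).
Hypotheses (s0_ge0 : 0 <= s0) (m_ge0 : 0 <= m) (l_ge0 : 0 <= l) (l'_ge0 : 0 <= l').
Hypotheses (L_ge1 : 1 <= L) (M_ge1 : 1 <= M).
Hypotheses (Hc : tame_bound V c) (Hc' : tame_bound W c).
Hypotheses (kap_ge0 : 0 <= kap) (sg_le : sg <= tau) (kap_le : s0 + m + kap <= tau)
  (tau_l : tau + l <= S) (tau_l' : tau + l' <= S).
Hypothesis l_leB : l <= B.
(** Exponents in the error of the truncated inverse: [E1] governs its low norm, [E2] and [E3] the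
    two terms of the tame bound in its high norm. Each leaves a spare factor L^(-eps), with which
    [L_large] absorbs the powers of c. *)
Hypothesis E1 : y * l' - (tau - s0 - m) + beta <= - B - eps.
Hypothesis E2 : y * (l' + m + kap) - kap <= - eps.
Hypothesis E3 : y * (l' + m + kap) + beta - (tau - s0 - m) <= - eps.
Hypothesis L_large : 16 * c ^+ 5 <= L `^ eps.
Hypothesis u_ball : sball V sg 1 u.
Hypothesis u_fix : Pi u = u.
Hypothesis u_high : snorm V tau u <= L `^ beta.
Hypothesis DF_lin : linear_on (sspace V (s0 + m)) (DF u).
Hypothesis DF_tame : forall s, s0 <= s -> s <= S - m -> forall h, sspace V (s + m) h ->
  sspace W s (DF u h) /\
  snorm W s (DF u h) <=
    c * (snorm V (s + m) h + snorm V (s + m) u * snorm V (s0 + m) h).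
Hypothesis Lu_inv : forall k, sspace W (s0 + l') k -> sspace V (s0 + m) (Lu k) ->
  DF u (Lu k) = k.
Hypothesis Lu_tame : forall s, s0 <= s -> s <= S - Num.max l l' ->
  sspace V (s + l) u -> forall k, sspace W (s + l') k ->
  sspace V s (Lu k) /\
  snorm V s (Lu k) <=
    c * (snorm W (s + l') k + snorm W (s0 + l') k * snorm V (s + l) u).

(* For h = Pi L(u) k and z = L(u) k - h the error is - Pi' DF(u) z. The operator
   Pi' DF(u) costs powers of M = L^y, but Pi - 1 gains powers of L; as y < 1 the
   gain wins once kap is large. *)
Lemma approximate_inverse k : Pi' k = k ->
  let h := Pi (Lu k) in
  let n := wnorm M p q (s0 + l') (tau + l') k in
  wnorm L p q s0 tau h <= 4 * c ^+ 3 * n /\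
  wnorm M p q (s0 + l') (tau + l') (Pi' (DF u h) - k) <= n / 2.
Proof.
move=> Pk h n.
have sgm : s0 + m <= sg by rewrite lerD2l le_max lexx.
have sgl : s0 + l <= sg by rewrite lerD2l le_max lexx orbT.
have [[i1 i2 i3 i4] [i5 i6 i7 i8 i9] [i10 i11 i12 i13 i14] [[i15 i16 i17]
  [i18 i19 i20 i21] [i22 i23 i24]]] := index_bounds s0_ge0 m_ge0 l_ge0 l'_ge0
  kap_ge0 kap_le tau_l tau_l'.
have [e1 [e2 [e3 [e4 e5]]]] : - B - eps + (l + beta) <= beta - eps /\
    y * l' + - (tau - s0 - m) + (beta - eps) <= - B - eps - eps /\
    y * (l' + m + kap) + - kap <= - eps /\
    y * (l' + m + kap) + beta + - (tau - s0 - m) <= - eps /\ s0 <= sg.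
  by move: E1 E2 E3 l_leB m_ge0 sgm; lra.
have c1 : 1 <= c by case: Hc.
have c0 : 0 < c by apply: lt_le_trans c1.
have L0 x : 0 < L `^ x by rewrite powR_gt0// (lt_le_trans ltr01).
have pp : 0 < p by exact: L0.
have qp : 0 < q by exact: L0.
have sgS : sg <= S by apply: le_trans sg_le i6.
have n1 : snorm W (s0 + l') k <= p * n by apply: wnorm_fst.
have n2 : snorm W (tau + l') k <= q * n by apply: wnorm_snd.
have su s : 0 <= s -> s <= S -> sspace V s u by apply: fixed_sspace u_fix.
have sk s : 0 <= s -> s <= S -> sspace W s k by apply: fixed_sspace Pk.
have n0 : 0 <= n.
  have : 0 <= p * n by apply: le_trans n1; apply: snorm_ge0 => //; exact: sk.
  by rewrite pmulr_rge0.
have u1 s : 0 <= s -> s <= sg -> snorm V s u <= 1.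
  move=> s_0 ssg; apply: ltW; apply: le_lt_trans u_ball.2.
  by apply: snorm_le => //; apply: su => //; exact: le_trans s_0 ssg.
have tmax : tau <= S - Num.max l l' by rewrite lerBrDr -lerBrDl ge_max !lerBrDl tau_l.
have key (s z2 : R) : s0 <= s -> s <= tau -> 0 <= s + l -> s + l <= S ->
    0 <= s + l' -> s + l' <= S -> snorm V (s + l) u <= z2 ->
    sspace V s (Lu k) /\
    snorm V s (Lu k) <= c * (snorm W (s + l') k + p * n * z2).
  move=> s0s st j1 j2 j3 j4 uz.
  have [] := Lu_tame s0s (le_trans st tmax) (su _ j1 j2) (sk _ j3 j4).
  move=> ? H; split=> //; apply: le_trans H _; rewrite ler_pM2l// lerD2l.
  by apply: ler_pM => //; apply: snorm_ge0 => //; [exact: sk|exact: su].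
have [sx0 x1] : sspace V s0 (Lu k) /\ snorm V s0 (Lu k) <= 2 * c * (p * n).
  have [//|? H] := key s0 1 (lexx _) i7 i20 i21 i1 i2; first exact: u1.
  split=> //; apply: le_trans H _; rewrite (mulrC 2) -[leRHS]mulrA ler_pM2l//.
  by rewrite mulr1 mulr_natl mulr2n lerD2r.
(* The estimate of L(u) k at index [tau] needs u at index [tau + l]; for u in E(L) this costs L^l,
   and since [l <= B] the weight p compensates for it. *)
have pq : p * L `^ (l + beta) <= q by rewrite powR_add// ler_powR.
have [sx x2] : sspace V tau (Lu k) /\ snorm V tau (Lu k) <= 2 * c ^+ 2 * (q * n).
  have [//|? H] := key tau (c * L `^ (l + beta)) i7 (lexx _) i22 tau_l i3 tau_l'.
    rewrite -{1}u_fix; apply: le_trans (projS Hc i5 i23 tau_l L_ge1 (su _ i5 i6)) _.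
    have -> : tau + l - tau = l by ring.
    by rewrite -powR_add// -mulrA ler_pM2l// ler_pM2l.
  split=> //; apply: le_trans H _.
  have -> : 2 * c ^+ 2 * (q * n) = c * (c * (q * n) + c * (q * n)) by ring.
  rewrite ler_pM2l//; apply: lerD.
    by apply: le_trans n2 _; rewrite ler_peMl// mulr_ge0// ltW.
  have -> : p * n * (c * L `^ (l + beta)) = c * (p * L `^ (l + beta) * n) by ring.
  by rewrite ler_pM2l// ler_wpM2r.
have Ph : Pi h = h by rewrite /h proj_idem.
split.
  have -> : 4 * c ^+ 3 * n = 2 * c ^+ 3 * n + 2 * c ^+ 3 * n by ring.
  apply: wnorm_le => //.
    apply: le_trans (projW Hc s0_ge0 (lexx s0) i8 L_ge1 sx0) _.
    apply: (@le_trans _ _ (c * (2 * c * (p * n)))); first by rewrite ler_pM2l.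
    have -> : p * (2 * c ^+ 3 * n) = c * (2 * c * (p * n)) * c by ring.
    by rewrite ler_peMr// !mulr_ge0// ltW.
  apply: le_trans (projW Hc i5 (lexx tau) i6 L_ge1 sx) _.
  have -> : q * (2 * c ^+ 3 * n) = c * (2 * c ^+ 2 * (q * n)) by ring.
  by rewrite ler_pM2l.
pose z := Lu k - h.
have sz : sspace V tau z by apply: sspaceB => //; exact: proj_sspace.
have szW s : 0 <= s -> s <= tau -> sspace V s z.
  by move=> s_0 st; apply: sspace_sub sz.
pose X := 2 * c ^+ 3 * (q * n).
have X0 : 0 <= X by rewrite !mulr_ge0// ?exprn_ge0// ltW.
have Nz s : 0 <= s -> s <= tau -> snorm V s z <= L `^ (- (tau - s)) * X.
  move=> s_0 st; apply: le_trans (projC Hc s_0 st i6 L_ge1 sx) _.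
  have -> : L `^ (- (tau - s)) * X = c * L `^ (- (tau - s)) * (2 * c ^+ 2 * (q * n)).
    by rewrite /X; ring.
  by rewrite ler_wpM2l// mulr_ge0// ltW.
have z1 : snorm V (s0 + m) z <= L `^ (- (tau - s0 - m)) * X.
  by rewrite (_ : tau - s0 - m = tau - (s0 + m)); [exact: Nz|ring].
have z0 : 0 <= snorm V (s0 + m) z by apply: snorm_ge0 => //; exact: szW.
have eE : Pi' (DF u h) - k = - Pi' (DF u z).
  have hE : h = (-1) *: z + Lu k by rewrite scaleN1r opprB subrK.
  have sxm : sspace V (s0 + m) (Lu k) by apply: sspace_sub sx.
  rewrite hE DF_lin ?Lu_inv//; [|exact: sk|exact: szW].
  by rewrite linearD Pk addrK scaleN1r linearN.
have Pe : Pi' (Pi' (DF u h) - k) = Pi' (DF u h) - k by rewrite linearB/= proj_idem// Pk.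
have e0 : sspace W s0 (DF u z) /\ snorm W s0 (DF u z) <=
    2 * c * (L `^ (- (tau - s0 - m)) * X).
  have [D1 D2] := DF_tame (lexx s0) i9 (szW _ i10 i11).
  split=> //; apply: le_trans D2 _; rewrite (mulrC 2) -[leRHS]mulrA ler_pM2l//.
  rewrite mulr_natl mulr2n; apply: lerD => //; apply: le_trans z1.
  by rewrite ler_piMl// u1.
have tkE : tau - m - kap + m = tau - kap by ring.
(* DF(u) z is measured [kap] derivatives below the top index [tau - m]. There z has gained L^(-kap),
   while returning to [tau + l'] costs only M^(l' + m + kap) = L^(y (l' + m + kap)). *)
have eh : sspace W (tau - m - kap) (DF u z) /\ snorm W (tau - m - kap) (DF u z) <=
    c * ((L `^ (- kap) + L `^ beta * L `^ (- (tau - s0 - m))) * X).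
  have [] := DF_tame i16 i17 (h := z); rewrite tkE; first exact: szW.
  move=> D1 D2; split=> //; apply: le_trans D2 _; rewrite ler_pM2l// mulrDl -mulrA.
  apply: lerD.
    have -> : L `^ (- kap) = L `^ (- (tau - (tau - kap))) by congr powR; ring.
    exact: Nz.
  apply: ler_pM z1 => //; first by apply: snorm_ge0 => //; exact: su.
  by apply: le_trans u_high; apply: snorm_le => //; exact: su.
have powM x : M `^ x = L `^ (y * x) by rewrite powRrM.
have sPe s x : 0 <= s -> s <= S -> snorm W s (Pi' (DF u z)) <= x ->
    snorm W s (Pi' (DF u h) - k) <= x.
  by move=> s_0 sS; rewrite eE snormN//; apply: proj_sspace.
have -> : n / 2 = n / 4 + n / 4 by field.
have Ln : 16 * c ^+ 5 * L `^ (- eps) <= 1.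
  by rewrite powRN ler_pdivrMr// mul1r.
have c5 : 0 <= c ^+ 5 by rewrite exprn_ge0// ltW.
have cM x : 0 <= c * M `^ x by rewrite powM mulr_ge0// ltW.
have pn : 0 <= p * n by rewrite mulr_ge0// ltW.
have qn : 0 <= q * n by rewrite mulr_ge0// ltW.
have Ln' x : 0 <= x -> x / 4 * (16 * c ^+ 5 * L `^ (- eps)) <= x / 4.
  by move=> x0; rewrite ler_piMr// divr_ge0.
apply: wnorm_le => //; apply: sPe => //.
  have [D1 D2] := e0.
  apply: le_trans (projS Hc' s0_ge0 i24 i2 M_ge1 D1) _.
  have -> : s0 + l' - s0 = l' by ring.
  apply: le_trans (ler_wpM2l (cM _) D2) _; rewrite powM /X.
  have -> : c * L `^ (y * l') * (2 * c * (L `^ (- (tau - s0 - m)) * (2 * c ^+ 3 * (q * n)))) =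
     4 * c ^+ 5 * n * (L `^ (y * l') * L `^ (- (tau - s0 - m)) * q) by ring.
  have H : L `^ (y * l') * L `^ (- (tau - s0 - m)) * q <= p * L `^ (- eps).
    by rewrite /p /q !powR_add// ler_powR.
  apply: (@le_trans _ _ (4 * c ^+ 5 * n * (p * L `^ (- eps)))).
    by apply: ler_wpM2l => //; apply: mulr_ge0 => //; apply: mulr_ge0.
  have -> : 4 * c ^+ 5 * n * (p * L `^ (- eps)) = (p * n / 4) * (16 * c ^+ 5 * L `^ (- eps)) by field.
  by rewrite [leRHS]mulrA; exact: Ln'.
have [D1 D2] := eh.
apply: le_trans (projS Hc' i18 i19 tau_l' M_ge1 D1) _.
have -> : tau + l' - (tau - m - kap) = l' + m + kap by ring.
apply: le_trans (ler_wpM2l (cM _) D2) _; rewrite powM /X; set w := y * _ in e3 e4 *.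
have -> : c * L `^ w * (c * ((L `^ (- kap) + L `^ beta * L `^ (- (tau - s0 - m))) *
   (2 * c ^+ 3 * (q * n)))) =
  2 * c ^+ 5 * (q * n) * (L `^ w * L `^ (- kap) + L `^ w * L `^ beta * L `^ (- (tau - s0 - m))) by ring.
have H : L `^ w * L `^ (- kap) + L `^ w * L `^ beta * L `^ (- (tau - s0 - m)) <= 2 * L `^ (- eps).
  by rewrite !powR_add// mulr_natl mulr2n; apply: lerD; rewrite ler_powR.
apply: (@le_trans _ _ (2 * c ^+ 5 * (q * n) * (2 * L `^ (- eps)))).
  by apply: ler_wpM2l => //; apply: mulr_ge0 => //; apply: mulr_ge0.
have -> : 2 * c ^+ 5 * (q * n) * (2 * L `^ (- eps)) = (q * n / 4) * (16 * c ^+ 5 * L `^ (- eps)) by field.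
by rewrite [leRHS]mulrA; exact: Ln'.
Qed.

End ApproximateInverse.

(* With y = 1 - (delta - l' - s1) / (6 (delta - l' - s0)) and beta = y^2 tau, each
   constraint becomes linear in tau, with a positive coefficient or a margin
   independent of tau; it then holds for large tau. *)
Lemma nash_moser_exponents (R : realType) (s0 m l l' s1 delta : R) :
  0 <= s0 -> 0 <= m -> 0 <= l -> 0 <= l' -> s0 <= s1 -> s1 + l' < delta ->
  exists y eps kap tau beta : R,
  [/\ [/\ 0 < y, y < 1, 0 < eps & 0 <= kap],
      [/\ s0 + m + kap <= tau, s0 + m + l' <= tau, s1 <= tau & delta <= tau],
      [/\ s1 - s0 + 2 * eps <= y * (y * y) * (delta - s0 - l'),
          y * y * (tau + l' - delta) <= beta - eps,
          s1 - s0 + 2 * eps <= y * y * (tau - m - s0 - l') - y * beta &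
          y * (l' + m) + y * beta <= beta - 2 * eps] &
      [/\ y * l' - (tau - s0 - m) + beta <= - (s1 - s0) - eps,
          y * (l' + m + kap) - kap <= - eps &
          y * (l' + m + kap) + beta - (tau - s0 - m) <= - eps]].
Proof.
move=> s0_ge0 m_ge0 l_ge0 l'_ge0 s01 sd.
pose A := delta - s0 - l'; pose B := s1 - s0.
have B0 : 0 <= B by rewrite /B; lra.
have AB : B < A by rewrite /A /B; lra.
have A0 : 0 < A by lra.
(* These z and eps satisfy (1 - 3 z) A = B + 2 eps, while y^3 >= 1 - 3 z; this gives the first
   inequality and uses A > B, that is, delta > s1 + l'. *)
pose z := (A - B) / (6 * A).
have z0 : 0 < z by rewrite divr_gt0 ?mulr_gt0// subr_gt0.
have zA : z * A = (A - B) / 6 by rewrite /z; field; rewrite gt_eqF.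
have z1 : z <= 1 / 6 by rewrite /z ler_pdivrMr ?mulr_gt0//; lra.
clearbody z; pose y := 1 - z; pose eps := (A - B) / 4.
have y0 : 0 < y by rewrite /y; lra.
have y1 : y < 1 by rewrite /y; lra.
have yz : 1 - y = z by rewrite /y; lra.
have eps0 : 0 < eps by rewrite divr_gt0// subr_gt0.
have y3 : 1 - 3 * z <= y * (y * y).
  have : 0 <= z * z * (3 - z) by rewrite !mulr_ge0//; lra.
  by rewrite /y; lra.
have R1 : B + 2 * eps <= y * (y * y) * A.
  apply: (@le_trans _ _ ((1 - 3 * z) * A)); last by rewrite ler_pM2r.
  by rewrite mulrBl mul1r -mulrA zA /eps; lra.
(* Chosen so that [E2] is an equality. *)
pose kap := (y * (l' + m) + eps) / z.
have kap0 : 0 <= kap.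
  by rewrite divr_ge0 ?(ltW z0)// addr_ge0 ?(ltW eps0)// mulr_ge0 ?(ltW y0)// addr_ge0.
have kapE : kap * z = y * (l' + m) + eps by rewrite /kap divfK// gt_eqF.
(* The third bound on [tau] pays for [E1] and [E3] out of tau - beta >= tau z, the second for [R3]
   and [R4] out of beta - y beta = tau y^2 z; the first orders the indices. *)
have [tau [t1 t2 t3]] : exists tau : R,
    [/\ s0 + m + kap + l' + s1 + delta + 1 <= tau,
        B + 2 * eps + l' + m + s0 + l' + m <= tau * (y * y * z) &
        s0 + m + l' + B + eps + (l' + m + kap) <= tau * z].
  have c1 : 0 < y * y * z by rewrite !mulr_gt0.
  pose T1 := s0 + m + kap + l' + s1 + delta + 1.
  pose T2 := B + 2 * eps + l' + m + s0 + l' + m.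
  pose T3 := s0 + m + l' + B + eps + (l' + m + kap).
  exists (Num.max T1 (Num.max (T2 / (y * y * z)) (T3 / z))).
  by split; rewrite -?ler_pdivrMr// !le_max lexx ?orbT.
pose beta := y * y * tau.
have tau0 : 0 <= tau by lra.
have yy1 : y * y <= 1 by rewrite mulr_ile1// ltW.
have yy0 : 0 <= y * y by rewrite mulr_ge0// ltW.
have b1 : beta - y * beta = tau * (y * y * z) by rewrite /beta -yz; ring.
have b2 : beta <= tau - tau * z.
  have -> : tau - tau * z = y * tau by rewrite -yz; ring.
  by rewrite /beta -mulrA ler_pM2l// ler_piMl// ltW.
have yx (x : R) : 0 <= x -> y * x <= x by move=> x0; rewrite ler_piMl// ltW.
have yx0 (x : R) : 0 <= x -> 0 <= y * x by move=> x0; rewrite mulr_ge0// ltW.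
have lm := yx (l' + m) ltac:(lra); have lmk := yx (l' + m + kap) ltac:(lra).
have yl := yx l' l'_ge0.
exists y, eps, kap, tau, beta; split; split=> //; try lra.
- have := yx (y * (y * A)) ltac:(by rewrite !mulr_ge0// ltW).
  have : y * y * (delta - l') = y * (y * A) + y * y * s0 by rewrite /A; ring.
  have : 0 <= y * y * s0 by rewrite mulr_ge0.
  have -> : y * y * (tau + l' - delta) = beta - y * y * (delta - l') by rewrite /beta; ring.
  by move: R1; rewrite -!mulrA; lra.
- have -> : y * y * (tau - m - s0 - l') = beta - y * y * (m + s0 + l') by rewrite /beta; ring.
  have : y * y * (m + s0 + l') <= m + s0 + l' by rewrite ler_piMl//; lra.
  by rewrite -/B; lra.
- by rewrite -/B; lra.
- have -> : y * (l' + m + kap) - kap = y * (l' + m) - kap * (1 - y) by ring.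
  by rewrite yz kapE; lra.
Qed.

Lemma tame_boundW (R : realType) (S : R) (V : tameScale S) (A A' : R) :
  A <= A' -> tame_bound V A -> tame_bound V A'.
Proof.
move=> AA' [A1 H]; split; first exact: le_trans AA'.
move=> s L s0 sS L1 u su; have [H1 H2] := H s L s0 sS L1 u su.
have N0 := snorm_ge0 s0 sS su.
by split=> t t0 tS; [apply: le_trans (H1 t t0 tS) _|apply: le_trans (H2 t t0 tS) _];
   rewrite -!mulrA ler_wpM2r// mulr_ge0// powR_ge0.
Qed.

(** * One step of the Nash-Moser iteration, for a family of data *)

Section NashMoserStep.
Variables (R : realType) (S : R) (V W : tameScale S) (s0 m l l' s1 : R).
Variables (F : V -> W) (DF : V -> V -> W).
Variables (c y eps kap tau beta : R).
Let sg := s0 + Num.max m l.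
Hypotheses (s0_ge0 : 0 <= s0) (m_ge0 : 0 <= m) (l_ge0 : 0 <= l) (l'_ge0 : 0 <= l').
Hypotheses (sg_le : sg <= s1) (Hc : tame_bound V c) (Hc' : tame_bound W c).
Hypotheses (y_gt0 : 0 < y) (y_lt1 : y < 1) (eps_gt0 : 0 < eps) (kap_ge0 : 0 <= kap).
Hypotheses (kap_le : s0 + m + kap <= tau)
  (l'_le : s0 + m + l' <= tau) (s1_le : s1 <= tau)
  (tau_l : tau + l <= S) (tau_l' : tau + l' <= S).
(** [R3] and [R4] make the part of F(u) cut off at frequency M1 small relative to p and q: in low
    norm it gains M1^(-(tau - m - s0 - l')), in high norm it loses M^(l' + m), and F(u) itself has
    size M^beta. The second eps in each pays for constants. *)
Hypothesis R3 : s1 - s0 + 2 * eps <= y * y * (tau - m - s0 - l') - y * beta.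
Hypothesis R4 : y * (l' + m) + y * beta <= beta - 2 * eps.
Hypothesis E1 : y * l' - (tau - s0 - m) + beta <= - (s1 - s0) - eps.
Hypothesis E2 : y * (l' + m + kap) - kap <= - eps.
Hypothesis E3 : y * (l' + m + kap) + beta - (tau - s0 - m) <= - eps.
Hypothesis F_diff : G_differentiable s0 m F DF.
Hypothesis F_0 : F 0 = 0.
Hypothesis DF_tame : forall s, s0 <= s -> s <= S - m ->
  forall u h, sball V (s0 + m) 1 u -> sspace V (s + m) u -> sspace V (s + m) h ->
  sspace W s (DF u h) /\
  snorm W s (DF u h) <=
    c * (snorm V (s + m) h + snorm V (s + m) u * snorm V (s0 + m) h).
Hypothesis right_inverse : forall u, sball V sg 1 u -> exists Lu : W -> V,
  (forall k, sspace W (s0 + l') k -> sspace V (s0 + m) (Lu k) -> DF u (Lu k) = k) /\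
  forall s, s0 <= s -> s <= S - Num.max l l' -> sspace V (s + l) u ->
    forall k, sspace W (s + l') k -> sspace V s (Lu k) /\
    snorm V s (Lu k) <=
      c * (snorm W (s + l') k + snorm W (s0 + l') k * snorm V (s + l) u).
Hypothesis F_galerkin : forall L L' : R, 1 <= L -> 1 <= L' ->
  galerkin_continuous s0 m l DF L L'.

Variable L : R.
Let M := L `^ y.
Let M1 := M `^ y.
Let p := L `^ (- (s1 - s0) - eps).
Let q := L `^ (beta - eps).
Hypotheses (L_ge1 : 1 <= L) (L_large : 16 * c ^+ 5 <= L `^ eps).

Let M_ge1 : 1 <= M.
Proof. by rewrite -(powRr0 L) ler_powR// ltW. Qed.
Let M1_ge1 : 1 <= M1.
Proof. by rewrite -(powRr0 M) ler_powR// ltW. Qed.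
Let M1_le : M1 <= M.
Proof. by rewrite -[leRHS]powRr1 ?ler_powR// ltW// (lt_le_trans ltr01). Qed.

Let bounds := index_bounds s0_ge0 m_ge0 l_ge0 l'_ge0 kap_ge0 kap_le tau_l tau_l'.

(* Pi'(M) F(u) - t' = Pi'(M) (1 - Pi'(M1)) F(u) + (t - t') when
   Pi'(M1) F(u) = t: only the high frequencies of F(u) enter. *)
Lemma residual_bound u t t' (eta : R) : 0 <= eta ->
  sball V (s0 + m) 1 u -> proj V M u = u -> snorm V tau u <= M `^ beta * eta ->
  proj W M1 (F u) = t -> proj W M (t - t') = t - t' ->
  snorm W (s0 + l') (t - t') <= p * (eta / 8) ->
  snorm W (tau + l') (t - t') <= q * (eta / 8) ->
  wnorm M p q (s0 + l') (tau + l') (proj W M (F u) - t') <= eta / 2.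
Proof.
move=> eta0 bu Pu ut Ft tf tl th.
have [[i1 i2 i3 i4] [i5 i6 i7 i8 i9] [i10 i11 i12 i13 i14] [[i15 i16 i17]
  [i18 i19 i20 i21] [i22 i23 i24]]] := bounds.
have c1 : 1 <= c by case: Hc.
have c0 : 0 < c by apply: lt_le_trans c1.
have L0 x : 0 < L `^ x by rewrite powR_gt0// (lt_le_trans ltr01).
have pp : 0 < p by exact: L0.
have qp : 0 < q by exact: L0.
have [j1 [j2 [j3 [j4 [j5 j6]]]]] : s0 <= tau - m /\ tau - m <= S - m /\
    0 <= tau - m /\ tau - m <= S /\ s0 + l' <= tau - m /\ tau - m <= tau + l'.
  by move: i6 i7 i5 i3 i9 s0_ge0 m_ge0 l'_ge0 l'_le kap_le kap_ge0; lra.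
have [sF NF] := F_tame s0_ge0 m_ge0 F_diff (lt_le_trans ltr01 c1) DF_tame F_0 j1 j2 bu
  ltac:(by rewrite subrK; apply: fixed_sspace Pu _ _).
rewrite subrK in NF.
have {ut}NF : snorm W (tau - m) (F u) <= 2 * c * (L `^ (y * beta) * eta).
  apply: le_trans NF _; rewrite ler_pM2l ?mulr_gt0// (le_trans ut)//.
  by rewrite /M -powRrM.
pose f := F u - proj W M1 (F u).
have fE : proj W M (F u) - t' = proj W M f + (t - t').
  rewrite -Ft linearB/=; have [_ ->] := proj_comp M1_ge1 M1_le (F u).
  by rewrite addrA subrK.
have sf : sspace W (tau - m) f by apply: sspaceB => //; exact: proj_sspace.
have sF0 : 0 <= snorm W (tau - m) (F u) by exact: snorm_ge0.
have Le : 16 * c ^+ 5 * L `^ (- eps) <= 1.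
  by rewrite powRN ler_pdivrMr// mul1r.
have c3 : 16 * c ^+ 3 * L `^ (- eps) <= 1.
  apply: le_trans Le; rewrite ler_wpM2r ?(ltW (L0 _))// ler_pM2l//.
  by rewrite ler_weXn2l.
have small x : 0 <= x -> 2 * c ^+ 3 * (x * L `^ (- eps) * eta) <= x * (eta / 8).
  move=> x0; have -> : 2 * c ^+ 3 * (x * L `^ (- eps) * eta) =
    x * (eta / 8) * (16 * c ^+ 3 * L `^ (- eps)) by field.
  by rewrite ler_piMr// mulr_ge0// divr_ge0.
have f1 : snorm W (s0 + l') (proj W M f) <= p * (eta / 8).
  have sf' : sspace W (s0 + l') f by apply: sspace_sub sf.
  apply: le_trans (projW Hc' i1 (lexx _) i2 M_ge1 sf') _.
  apply: le_trans (ler_wpM2l (ltW c0) (projC Hc' i1 j5 j4 M1_ge1 sF)) _.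
  rewrite /M1 /M -!powRrM; set e := y * (y * _).
  apply: (@le_trans _ _ (c * (c * L `^ e * (2 * c * (L `^ (y * beta) * eta))))).
    by rewrite ler_pM2l// ler_pM2l// mulr_gt0.
  have -> : c * (c * L `^ e * (2 * c * (L `^ (y * beta) * eta))) =
     2 * c ^+ 3 * (L `^ e * L `^ (y * beta) * eta) by ring.
  apply: le_trans (small p (ltW pp)); rewrite ler_pM2l; last by rewrite mulr_gt0// exprn_gt0.
  rewrite ler_wpM2r// /p !powR_add// ler_powR//.
  have -> : e = - (y * y * (tau - m - s0 - l')) by rewrite /e; ring.
  by move: R3; lra.
have f2 : snorm W (tau + l') (proj W M f) <= q * (eta / 8).
  apply: le_trans (projS Hc' j3 j6 tau_l' M_ge1 sf) _.
  have cM : 0 <= c * M `^ (tau + l' - (tau - m)).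
    by rewrite mulr_ge0// ?powR_ge0// ltW.
  apply: le_trans (ler_wpM2l cM (projC Hc' j3 (lexx _) j4 M1_ge1 sF)) _.
  rewrite subrr oppr0 powRr0 mulr1 /M -!powRrM; set e := y * (_ - _).
  apply: (@le_trans _ _ (c * L `^ e * (c * (2 * c * (L `^ (y * beta) * eta))))).
    by rewrite ler_pM2l ?mulr_gt0// ler_pM2l.
  have -> : c * L `^ e * (c * (2 * c * (L `^ (y * beta) * eta))) =
     2 * c ^+ 3 * (L `^ e * L `^ (y * beta) * eta) by ring.
  apply: le_trans (small q (ltW qp)); rewrite ler_pM2l; last by rewrite mulr_gt0// exprn_gt0.
  rewrite ler_wpM2r// /q !powR_add// ler_powR//.
  have -> : e = y * (l' + m) by rewrite /e; ring.
  by move: R4; lra.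
rewrite fE; apply: (le_trans (wnormD i1 i4 tau_l' M_ge1 pp qp _ _)).
have -> : eta / 2 = (eta / 8 + eta / 8) + (eta / 8 + eta / 8) by field.
by apply: lerD; apply: wnorm_le => //; rewrite proj_idem.
Qed.

(** [eta b] will be the size of the datum b relative to the radius r. All bounds are kept
    proportional to it, so the linear bound on G, and with it G(0) = 0, results from the iteration
    itself. *)
Variables (B : normedModType R) (P : set B) (eta : B -> R) (g : B -> V)
  (t w : B -> W) (r1 : R).
Hypothesis eta_ge0 : forall b, P b -> 0 <= eta b.
Hypothesis eta_lt1 : forall b, P b -> eta b < 1.
Hypothesis g_fix : forall b, P b -> proj V M (g b) = g b.
Hypothesis g_low : forall b, P b -> snorm V s1 (g b) <= r1 * eta b.
Hypothesis g_high : forall b, P b -> snorm V tau (g b) <= M `^ beta * eta b.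
Hypothesis g_sol : forall b, P b -> proj W M1 (F (g b)) = t b.
Hypothesis g_cont : forall b, P b -> forall e : R, 0 < e -> exists2 r, 0 < r &
  forall b', P b' -> `|b - b'| < r -> snorm V s1 (g b - g b') < e.
Hypothesis w_fix : forall b, P b -> proj W M1 (w b) = w b.
Hypothesis w_cont : forall b, P b -> forall e : R, 0 < e -> exists2 r, 0 < r &
  forall b', P b' -> `|b - b'| < r -> snorm W s0 (w b - w b') < e.
Hypothesis tw_low : forall b, P b -> snorm W (s0 + l') (t b - w b) <= p * (eta b / 8).
Hypothesis tw_high : forall b, P b -> snorm W (tau + l') (t b - w b) <= q * (eta b / 8).
Hypothesis r1_small : 0 <= r1 /\ r1 + 8 * c ^+ 4 * L `^ (- eps) <= 1.

Lemma nash_moser_step : exists g' : B -> V,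
  [/\ forall b, P b -> proj V L (g' b) = g' b,
      forall b, P b -> proj W M (F (g' b)) = w b,
      forall b, P b -> snorm V s1 (g' b - g b) <= 8 * c ^+ 4 * L `^ (- eps) * eta b,
      forall b, P b -> snorm V tau (g' b) <= L `^ beta * eta b &
      forall b, P b -> forall e : R, 0 < e -> exists2 r, 0 < r &
        forall b', P b' -> `|b - b'| < r -> snorm V s1 (g' b - g' b') < e].
Proof.
have [[i1 i2 i3 i4] [i5 i6 i7 i8 i9] [i10 i11 i12 i13 i14] [[i15 i16 i17]
  [i18 i19 i20 i21] [i22 i23 i24]]] := bounds.
have c1 : 1 <= c by case: Hc.
have c0 : 0 < c by apply: lt_le_trans c1.
have L0 x : 0 < L `^ x by rewrite powR_gt0// (lt_le_trans ltr01).
have pp : 0 < p by exact: L0.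
have qp : 0 < q by exact: L0.
have sgm : s0 + m <= sg by rewrite lerD2l le_max lexx.
have sgl : s0 + l <= sg by rewrite lerD2l le_max lexx orbT.
have sg0 : 0 <= sg by apply: le_trans i10 sgm.
have s10 : 0 <= s1 by apply: le_trans sg0 sg_le.
have s1S : s1 <= S by apply: le_trans s1_le i6.
have sgS : sg <= S by apply: le_trans sg_le s1S.
have sgt : sg <= tau by apply: le_trans sg_le s1_le.
have s01 : s0 <= s1 by apply: le_trans sg_le; apply: le_trans sgm; rewrite lerDl.
have M_le : M <= L.
  by rewrite -[leRHS]powRr1 ?ler_powR// ltW// (lt_le_trans ltr01).
have l_le : l <= s1 - s0 by rewrite lerBrDl; exact: le_trans sg_le.
have gL b : P b -> proj V L (g b) = g b.
  by move=> Pb; rewrite -(g_fix Pb); have [_ ->] := proj_comp M_ge1 M_le (g b).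
have wM b : P b -> proj W M (w b) = w b.
  by move=> Pb; rewrite -(w_fix Pb); have [_ ->] := proj_comp M1_ge1 M1_le (w b).
have gball b : P b -> sball V sg 1 (g b).
  move=> Pb; split; first by apply: fixed_sspace (gL b Pb) _ _.
  apply: le_lt_trans (eta_lt1 Pb); apply: (@le_trans _ _ (snorm V s1 (g b))).
    by apply: snorm_le => //; apply: fixed_sspace (gL b Pb) _ _.
  apply: le_trans (g_low Pb) _; rewrite ler_piMl ?eta_ge0//.
  by apply: le_trans r1_small.2; rewrite lerDl !mulr_ge0// ?exprn_ge0// ltW.
pose N := @wnorm R S V L p q s0 tau.
pose N' := @wnorm R S W M p q (s0 + l') (tau + l').
have ND u v : N (u + v) <= N u + N v by exact: wnormD.
have NZ (a : R) u : N (a *: u) = `|a| * N u by exact: wnormZ.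
have N'D u v : N' (u + v) <= N' u + N' v by exact: wnormD.
have N'Z (a : R) u : N' (a *: u) = `|a| * N' u by exact: wnormZ.
have Nfst u : proj V L u = u -> snorm V s0 u <= p * N u by exact: wnorm_fst.
have Nsnd u : proj V L u = u -> snorm V tau u <= q * N u by exact: wnorm_snd.
have N'fst k : proj W M k = k -> snorm W (s0 + l') k <= p * N' k by exact: wnorm_fst.
have sE u s : proj V L u = u -> 0 <= s -> s <= S -> sspace V s u.
  by move=> Pu; apply: fixed_sspace Pu.
have [K1 K10 HK1] : exists2 K : R, 0 < K &
    forall u, sspace V s0 u -> N (proj V L u) <= K * snorm V s0 u.
  exact: (wnorm_equiv i7 i6 L_ge1 pp qp Hc s0_ge0 (lexx _)).
have [K' K'0 HK'] : exists2 K : R, 0 < K &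
    forall u, sspace W s0 u -> N' (proj W M u) <= K * snorm W s0 u.
  exact: (wnorm_equiv i4 tau_l' M_ge1 pp qp Hc' s0_ge0 i24).
pose K := q + K1.
have K0 : 0 < K by rewrite addr_gt0.
have N_ge0 u : proj V L u = u -> 0 <= N u.
  move=> Pu; rewrite -(pmulr_rge0 _ pp); apply: le_trans (Nfst _ Pu).
  by apply: snorm_ge0 => //; exact: sE.
have N_ge u s : proj V L u = u -> 0 <= s -> s <= tau -> snorm V s u <= q * N u.
  move=> Pu s_0 st; apply: le_trans (Nsnd _ Pu); apply: snorm_le => //.
  by apply: sE.
(* The bound at index [tau] is not implied by the ball; the approximate inverse needs it, so the
   descent must be kept from losing it. *)
pose Om := [set u | sball V sg 1 u /\ snorm V tau u <= L `^ beta].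
have Om_inv u k : Om u -> proj V L u = u -> proj W M k = k -> exists h,
    [/\ proj V L h = h, N h <= 4 * c ^+ 3 * N' k &
        N' (proj W M (DF u h) - k) <= N' k / 2].
  move=> [bu ut] Pu Pk; have [Lu [Lu1 Lu2]] := right_inverse bu.
  have bum : sball V (s0 + m) 1 u by apply: sballW bu.
  have [DFl _ _] := F_diff bum.
  have DFu s : s0 <= s -> s <= S - m -> forall h, sspace V (s + m) h ->
      sspace W s (DF u h) /\ snorm W s (DF u h) <=
        c * (snorm V (s + m) h + snorm V (s + m) u * snorm V (s0 + m) h).
    move=> s0s sS h sh; apply: DF_tame => //; apply: sE => //.
      by apply: le_trans i10 _; rewrite lerD2r.
    by rewrite -lerBrDr.
  have [H1 H2] := @approximate_inverse R S V W s0 m l l' DF Lu u c L y (s1 - s0) beta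
    tau kap eps s0_ge0 m_ge0 l_ge0 l'_ge0 L_ge1 M_ge1 Hc Hc' kap_ge0 sgt kap_le
    tau_l tau_l' l_le E1 E2 E3 L_large bu Pu ut DFl
    DFu
    Lu1 Lu2 k Pk.
  by exists (proj V L (Lu k)); rewrite proj_idem.
have res b : P b -> N' (proj W M (F (g b)) - w b) <= eta b / 2.
  move=> Pb; apply: (residual_bound (t := t b)) => //.
  - exact: eta_ge0.
  - by apply: sballW (gball b Pb).
  - exact: g_fix.
  - exact: g_high.
  - exact: g_sol.
  - rewrite linearB/= wM// -(g_sol Pb).
    by have [_ ->] := proj_comp M1_ge1 M1_le (F (g b)).
  - exact: tw_low.
  - exact: tw_high.
have c5L : 16 * c ^+ 5 * L `^ (- eps) <= 1.
  by rewrite powRN ler_pdivrMr// mul1r.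
(* The residual is at most eta / 2, so the distance allowed is 8 c^3 eta. Raising the index from s0
   to s1 costs L^(s1 - s0), and the weight p leaves L^(-eps). At index [tau] the increment and the
   old iterate, of size M^beta = L^(y beta), take at most half of L^beta eta each. *)
have move_le b u : P b -> proj V L u = u ->
    N (u - g b) <= 4 * (4 * c ^+ 3) * N' (proj W M (F (g b)) - w b) ->
    snorm V s1 (u - g b) <= 8 * c ^+ 4 * L `^ (- eps) * eta b /\
    snorm V tau u <= L `^ beta * eta b.
  move=> Pb Pu /le_trans Nu; have e0 := eta_ge0 Pb.
  have {}Nu : N (u - g b) <= 8 * c ^+ 3 * eta b.
    apply: Nu; have -> : 8 * c ^+ 3 * eta b = 4 * (4 * c ^+ 3) * (eta b / 2) by field.
    by rewrite ler_pM2l ?res// !mulr_gt0// exprn_gt0.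
  have Pug : proj V L (u - g b) = u - g b by rewrite linearB/= Pu gL.
  split.
    rewrite -{1}Pug.
    apply: le_trans (projS Hc s0_ge0 s01 s1S L_ge1 (sE _ _ Pug s0_ge0 i8)) _.
    apply: (@le_trans _ _ (c * L `^ (s1 - s0) * (p * (8 * c ^+ 3 * eta b)))).
      rewrite ler_pM2l ?mulr_gt0//; apply: le_trans (Nfst _ Pug) _.
      by rewrite ler_pM2l.
    have -> : c * L `^ (s1 - s0) * (p * (8 * c ^+ 3 * eta b)) =
      8 * c ^+ 4 * (L `^ (s1 - s0) * p) * eta b by ring.
    rewrite /p powR_add// (_ : s1 - s0 + (- (s1 - s0) - eps) = - eps)//; ring.
  rewrite -[u](subrK (g b)).
  apply: le_trans (snormD i5 i6 (sE _ _ Pug i5 i6) (sE _ _ (gL b Pb) i5 i6)) _.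
  have h1 : snorm V tau (u - g b) <= L `^ beta * eta b / 2.
    apply: le_trans (Nsnd _ Pug) _.
    apply: (@le_trans _ _ (q * (8 * c ^+ 3 * eta b))); first by rewrite ler_pM2l.
    rewrite /q -powR_add//.
    have -> : L `^ beta * L `^ (- eps) * (8 * c ^+ 3 * eta b) =
      L `^ beta * eta b / 2 * (16 * c ^+ 3 * L `^ (- eps)) by field.
    rewrite ler_piMr//; first by rewrite divr_ge0// mulr_ge0// ltW.
    apply: le_trans c5L; rewrite ler_wpM2r ?(ltW (L0 _))// ler_pM2l//.
    by rewrite ler_weXn2l.
  have h2 : snorm V tau (g b) <= L `^ beta * eta b / 2.
    apply: le_trans (g_high Pb) _; rewrite mulrAC ler_wpM2r// /M -powRrM.
    apply: (@le_trans _ _ (L `^ (beta + - eps))).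
      rewrite ler_powR//.
      have : 0 <= y * (l' + m) by rewrite mulr_ge0 ?addr_ge0// ltW.
      by move: R4 eps_gt0; lra.
    rewrite -powR_add// ler_pM2l//.
    have : L `^ (- eps) * 2 <= 1.
      apply: le_trans c5L; rewrite mulrC ler_wpM2r ?(ltW (L0 _))//.
      have : 1 <= c ^+ 5 by rewrite exprn_ege1.
      by lra.
    by rewrite -ler_pdivlMr// div1r.
  rewrite [leRHS](splitr (L `^ beta * eta b)).
  exact: lerD.
have near b u : P b -> proj V L u = u ->
    N (u - g b) <= 4 * (4 * c ^+ 3) * N' (proj W M (F (g b)) - w b) -> Om u.
  move=> Pb Pu Nu; have [h1 h2] := move_le b u Pb Pu Nu.
  have e1 := eta_lt1 Pb; have e0 := eta_ge0 Pb.
  split; last first.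
    by apply: le_trans h2 _; rewrite ler_piMr// ltW.
  split; first exact: sE.
  apply: (@le_lt_trans _ _ (snorm V s1 u)); first by apply: snorm_le => //; exact: sE.
  rewrite -[u](subrK (g b)); apply: le_lt_trans e1.
  have sug : sspace V s1 (u - g b) by apply: sE => //; rewrite linearB/= Pu gL.
  apply: le_trans (snormD s10 s1S sug (sE _ _ (gL b Pb) s10 s1S)) _.
  apply: le_trans (lerD h1 (g_low Pb)) _.
  by rewrite -mulrDl ler_piMl// addrC; case: r1_small.
have h_C : 0 < 4 * c ^+ 3 by rewrite mulr_gt0// exprn_gt0.
have h_ge u : proj V L u = u -> snorm V sg u <= K * N u.
  move=> Pu; apply: le_trans (N_ge u sg Pu sg0 sgt) _.
  by rewrite ler_wpM2r ?N_ge0// lerDl ltW.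
have h_le u : proj V L u = u -> N u <= K * snorm V s0 u.
  move=> Pu; rewrite -{1}Pu; apply: le_trans (HK1 u (sE _ _ Pu s0_ge0 i8)) _.
  rewrite ler_wpM2r ?lerDr ?(ltW qp)//; apply: snorm_ge0 => //; exact: sE.
have h_eq0 k : proj W M k = k -> N' k = 0 -> k = 0.
  move=> Pk k0; have := N'fst k Pk; rewrite k0 mulr0 => k1.
  have sk : sspace W (s0 + l') k by apply: fixed_sspace Pk _ _.
  by apply: (snorm_eq0 i1 i2 sk); apply/eqP; rewrite eq_le k1 snorm_ge0.
have h_ball u : Om u -> proj V L u = u -> sball V sg 1 u by case.
have h_gc b : P b -> forall e : R, 0 < e -> exists2 r, 0 < r &
    forall b', P b' -> `|b - b'| < r -> N (g b - g b') < e.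
  move=> Pb e e0; have [r r0 Hr] := g_cont Pb (divr_gt0 e0 K10).
  exists r => // b' Pb' bb'.
  have Pd : proj V L (g b - g b') = g b - g b' by rewrite linearB/= !gL.
  rewrite -Pd; apply: le_lt_trans (HK1 _ (sE _ _ Pd s0_ge0 i8)) _.
  rewrite mulrC -ltr_pdivlMr//; apply: le_lt_trans (Hr _ Pb' bb').
  by apply: snorm_le => //; exact: sE.
have h_wc b : P b -> forall e : R, 0 < e -> exists2 r, 0 < r &
    forall b', P b' -> `|b - b'| < r -> N' (w b - w b') < e.
  move=> Pb e e0; have [r r0 Hr] := w_cont Pb (divr_gt0 e0 K'0).
  exists r => // b' Pb' bb'.
  have Pd : proj W M (w b - w b') = w b - w b' by rewrite linearB/= !wM.
  have sd : sspace W s0 (w b - w b') by apply: fixed_sspace Pd _ _.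
  rewrite -Pd; apply: le_lt_trans (HK' _ sd) _.
  by rewrite mulrC -ltr_pdivlMr//; exact: Hr.
have [g' [G1 G2 G3 G4]] := @galerkin_step R S V W s0 m l F DF c c c L M s0_ge0 m_ge0
  sgS L_ge1 M_ge1 c0 Hc Hc' F_diff DF_tame (F_galerkin L_ge1 M_ge1) N N'
  (4 * c ^+ 3) K K' Om h_C ND NZ N'D N'Z K0 K'0 h_ge h_le HK' h_eq0 h_ball Om_inv
  B P g w gL wM h_gc h_wc near.
exists g'; split=> //.
- by move=> b Pb; have [] := move_le b (g' b) Pb (G1 b Pb) (G3 b Pb).
- by move=> b Pb; have [] := move_le b (g' b) Pb (G1 b Pb) (G3 b Pb).
- move=> b Pb e e0; have [r r0 Hr] := G4 b Pb (e / q) (divr_gt0 e0 qp).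
  exists r => // b' Pb' bb'; apply: le_lt_trans (N_ge _ _ _ s10 s1_le) _.
    by rewrite linearB/= !G1.
  by rewrite mulrC -ltr_pdivlMr//; exact: Hr.
Qed.

End NashMoserStep.

(** * The sequence of frequencies and geometric decay *)

Lemma powR_ge1 (R : realType) (b x : R) : 1 <= b -> 0 <= x -> 1 <= b `^ x.
Proof. by move=> b1 x0; rewrite -(powRr0 b) ler_powR. Qed.

(** Passing to the power 1/y multiplies lam^eps by (lam^eps)^d with d = 1/y - 1. The starting value
    makes this factor at least 2, and it stays so because the sequence increases. *)
Lemma growth_sequence (R : realType) (y eps a : R) :
  0 < y -> y < 1 -> 0 < eps -> 1 <= a -> exists lam : nat -> R,
  forall n, [/\ 1 <= lam n, lam n.+1 `^ y = lam n & a * 2 ^+ n <= lam n `^ eps].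
Proof.
move=> y0 y1 eps0 a1; pose d := y^-1 - 1.
have d0 : 0 < d by rewrite subr_gt0 invf_gt1.
have a0 : 0 < a by apply: lt_le_trans a1.
pose a' := a * 2 `^ d^-1.
have a'a : a <= a' by rewrite /a' ler_peMr ?(ltW a0)// powR_ge1 ?ler1n// invr_ge0 ltW.
have a'd : 2 <= a' `^ d.
  apply: (@le_trans _ _ ((2 `^ d^-1) `^ d)).
    by rewrite -powRrM mulVf ?gt_eqF// powRr1.
  apply: ge0_ler_powR; rewrite ?nnegrE ?powR_ge0 ?(ltW d0)//.
    by rewrite mulr_ge0 ?powR_ge0// ltW.
  by rewrite /a' ler_peMl ?powR_ge0.
pose lam := fix lam n := if n is k.+1 then lam k `^ y^-1 else a' `^ eps^-1.
have lam1 n : 1 <= lam n.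
  elim: n => [|n IH] /=.
    by rewrite powR_ge1 ?invr_ge0 ?(ltW eps0)// (le_trans a1).
  by rewrite powR_ge1// invr_ge0 ltW.
have lamy n : lam n.+1 `^ y = lam n.
  by rewrite /= -powRrM mulVf ?gt_eqF// powRr1// (le_trans ler01).
exists lam => n; split=> //.
suff : a' * 2 ^+ n <= lam n `^ eps.
  by apply: le_trans; rewrite ler_wpM2r// exprn_ge0.
elim: n => [|n IH].
  by rewrite expr0 mulr1 /= -powRrM mulVf ?gt_eqF// powRr1// ltW// (lt_le_trans a0).
have -> : lam n.+1 `^ eps = lam n `^ eps * (lam n `^ eps) `^ d.
  rewrite /= -!powRrM powR_add//; congr powR; rewrite /d; ring.
rewrite exprSr mulrA; apply: ler_pM => //.
  by rewrite mulr_ge0 ?exprn_ge0// (le_trans (ltW a0)).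
apply: le_trans a'd _; apply: ge0_ler_powR; rewrite ?nnegrE ?powR_ge0 ?(ltW d0)//.
  by rewrite (le_trans (ltW a0)).
apply: le_trans IH; rewrite ler_peMr ?exprn_ege1 ?ler1n//.
by rewrite (le_trans (ltW a0)).
Qed.

Lemma half_pow_lt (R : realType) (C e : R) : 0 < e -> exists n, C * 2^-1 ^+ n < e.
Proof.
move=> e0; have C0 : 0 < `|C| + 1 by rewrite ltr_wpDl.
have h0 : 0 < e / (`|C| + 1) by rewrite divr_gt0.
have [n _ Hn] : \forall n \near \oo, (2^-1 : R) ^+ n < e / (`|C| + 1).
  have : (fun n => (2^-1 : R) ^+ n) @ \oo --> (0 : R).
    by apply: cvg_expr; rewrite ger0_norm ?invr_ge0// invf_lt1 ?ltr1n.
  move=> /cvgrPdist_lt/(_ _ h0)[n _ Hn]; exists n => // k /= nk.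
  by have := Hn k nk; rewrite /= sub0r normrN ger0_norm// exprn_ge0.
exists n; have := Hn n (leqnn n); rewrite /= ltr_pdivlMr//; apply: le_lt_trans.
rewrite mulrC ler_wpM2l ?exprn_ge0//.
by apply: le_trans (ler_norm _) _; rewrite lerDl.
Qed.

Lemma le0_half_pow (R : realType) (C x : R) :
  (forall n, x <= C * 2^-1 ^+ n) -> x <= 0.
Proof.
move=> H; rewrite leNgt; apply/negP => x0.
by have [n] := half_pow_lt C x0; rewrite ltNge H.
Qed.

(** * Changes of the target between consecutive steps *)

Section TargetIncrement.
Variables (R : realType) (S : R) (W : tameScale S).
Variables (s0 l' s1 delta y eps tau beta c L M1 M2 r : R).
Let p := L `^ (- (s1 - s0) - eps).
Let q := L `^ (beta - eps).
Hypotheses (M1E : M1 = (L `^ y) `^ y) (M2E : M2 = M1 `^ y).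
Hypotheses (s0_ge0 : 0 <= s0) (l'_ge0 : 0 <= l') (y_gt0 : 0 < y) (eps_gt0 : 0 < eps).
Hypotheses (delta_ge : s0 + l' <= delta) (delta_le : delta <= tau) (tau_le : tau + l' <= S).
Hypothesis R1 : s1 - s0 + 2 * eps <= y * (y * y) * (delta - s0 - l').
Hypothesis R2 : y * y * (tau + l' - delta) <= beta - eps.
Hypotheses (Hc : tame_bound W c) (L_ge1 : 1 <= L) (r_ge0 : 0 <= r).
Hypothesis r_le1 : 8 * c ^+ 2 * r <= 1.

Let M1_ge1 : 1 <= M1.
Proof. by rewrite M1E !powR_ge1// ltW. Qed.
Let M2_ge1 : 1 <= M2.
Proof. by rewrite M2E powR_ge1// ltW. Qed.
Let c_ge1 : 1 <= c. Proof. by case: Hc. Qed.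

(** The target preceding the first one is 0, so no low frequencies cancel; smallness in the low norm
    comes from the choice of r instead. *)
Lemma first_target_bound v (eta : R) : 8 * c ^+ 2 * r <= p ->
  0 <= eta -> sspace W delta v -> snorm W delta v <= r * eta ->
  snorm W (s0 + l') (proj W M1 v) <= p * (eta / 8) /\
  snorm W (tau + l') (proj W M1 v) <= q * (eta / 8).
Proof.
move=> rp eta0 sv Nv.
have [i1 [i2 [i3 [i4 i5]]]] : 0 <= s0 + l' /\ s0 + l' <= S /\ 0 <= delta /\
    delta <= S /\ delta <= tau + l'.
  by move: s0_ge0 l'_ge0 delta_ge delta_le tau_le; lra.
have c0 : 0 < c by apply: lt_le_trans c_ge1.
have L0 x : 0 < L `^ x by rewrite powR_gt0// (lt_le_trans ltr01).
have cr x : 8 * c ^+ 2 * r <= x -> c * (r * eta) <= x * (eta / 8).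
  move=> rx; apply: (@le_trans _ _ (8 * c ^+ 2 * r * (eta / 8))); last first.
    by rewrite ler_wpM2r// divr_ge0.
  have -> : 8 * c ^+ 2 * r * (eta / 8) = c * (c * (r * eta)) by field.
  by rewrite ler_pM2l// ler_peMl// mulr_ge0.
split.
  apply: le_trans (projW Hc i1 delta_ge i4 M1_ge1 sv) _.
  by apply: le_trans (cr _ rp); rewrite ler_pM2l.
apply: le_trans (projS Hc i3 i5 tau_le M1_ge1 sv) _.
have -> : M1 `^ (tau + l' - delta) = L `^ (y * y * (tau + l' - delta)).
  by rewrite M1E -!powRrM mulrA.
have := R2; set e := y * y * _ => R2e.
apply: (@le_trans _ _ (L `^ e * (1 * (eta / 8)))).
  rewrite mulrAC mulrC ler_pM2l//; apply: le_trans (cr _ r_le1).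
  by rewrite ler_pM2l.
by rewrite mul1r ler_wpM2r ?divr_ge0// ler_powR.
Qed.

(** Up to sign the increment is the projection at M1 of the part of v above M2. In low norm it gains
    M2^(-(delta - s0 - l')), where M2 = L^(y^3), which [R1] compares with p; in high norm M1 =
    L^(y^2) leads to [R2]. *)
Lemma next_target_bound v (eta : R) : y < 1 ->
  0 <= eta -> sspace W delta v -> snorm W delta v <= r * eta ->
  snorm W (s0 + l') (proj W M2 v - proj W M1 v) <= p * (eta / 8) /\
  snorm W (tau + l') (proj W M2 v - proj W M1 v) <= q * (eta / 8).
Proof.
move=> y1 eta0 sv Nv.
have [i1 [i2 [i3 [i4 [i5 i6]]]]] : 0 <= s0 + l' /\ s0 + l' <= S /\ 0 <= delta /\
    delta <= S /\ delta <= tau + l' /\ 0 <= tau + l'.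
  by move: s0_ge0 l'_ge0 delta_ge delta_le tau_le; lra.
have c0 : 0 < c by apply: lt_le_trans c_ge1.
have L0 x : 0 < L `^ x by rewrite powR_gt0// (lt_le_trans ltr01).
have M21 : M2 <= M1.
  by rewrite M2E; exact: (ler1_powR M1_ge1 (ltW y1)).
pose f := v - proj W M2 v.
have fE : proj W M2 v - proj W M1 v = - proj W M1 f.
  by rewrite linearB/= opprB; have [_ ->] := proj_comp M2_ge1 M21 v.
have sf : sspace W delta f by apply: sspaceB => //; exact: proj_sspace.
have sP s : 0 <= s -> s <= S -> sspace W s (proj W M1 f) by exact: proj_sspace.
rewrite fE !snormN//; try exact: sP.
have main x e : e <= x -> c * (c * L `^ e * snorm W delta v) <= L `^ x * (eta / 8).
  move=> ex.
  have -> : c * (c * L `^ e * snorm W delta v) = L `^ e * (c ^+ 2 * snorm W delta v) by ring.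
  apply: ler_pM; rewrite ?(ltW (L0 _)) ?mulr_ge0 ?exprn_ge0 ?(ltW c0) ?snorm_ge0//.
    by rewrite ler_powR.
  apply: (@le_trans _ _ (c ^+ 2 * (r * eta))); first by rewrite ler_pM2l// exprn_gt0.
  have -> : c ^+ 2 * (r * eta) = 8 * c ^+ 2 * r * (eta / 8) by field.
  by rewrite ler_piMl// divr_ge0.
split.
  have sf' : sspace W (s0 + l') f by apply: sspace_sub sf.
  apply: le_trans (projW Hc i1 (lexx _) i2 M1_ge1 sf') _.
  apply: le_trans (ler_wpM2l (ltW c0) (projC Hc i1 delta_ge i4 M2_ge1 sv)) _.
  rewrite M2E M1E -!powRrM; apply: main.
  have -> : y * (y * (y * - (delta - (s0 + l')))) =
    - (y * (y * y) * (delta - s0 - l')) by ring.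
  by move: R1 eps_gt0; lra.
apply: le_trans (projS Hc i3 i5 tau_le M1_ge1 sf) _.
have cM : 0 <= c * M1 `^ (tau + l' - delta) by rewrite mulr_ge0 ?powR_ge0// ltW.
apply: le_trans (ler_wpM2l cM (projC Hc i3 (lexx _) i4 M2_ge1 sv)) _.
rewrite subrr oppr0 powRr0 mulr1 mulrCA mulrA M1E -!powRrM -!mulrA.
rewrite (mulrA c (L `^ _)); apply: main.
by rewrite mulrA.
Qed.

End TargetIncrement.

(** * Assembly of the iteration and passage to the limit *)

Theorem theorem8 (R : realType) (s0 m l l' s1 delta : R)
    (hs0 : 0 <= s0) (hm : 0 <= m) (hl : 0 <= l) (hl' : 0 <= l')
    (hs1 : s0 + Num.max m l <= s1) (hdelta : s1 + l' < delta) :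
  exists Smin : R, forall S : R, Smin < S ->
  forall (V W : tameScale S) (F : V -> W) (DF : V -> V -> W),
    (forall u, sball V (s0 + m) 1 u -> sspace W s0 (F u)) ->
    tame_differentiable s0 m F DF ->
    F 0 = 0 ->
    tame_right_invertible s0 m l l' DF ->
    (forall L L' : R, 1 <= L -> 1 <= L' ->
       galerkin_continuous s0 m l DF L L') ->
  exists r : R, 0 < r /\
  exists G : W -> V,
    [/\ forall v, sball W delta r v -> sball V s1 1 (G v),
        scontinuous_on delta s1 (sball W delta r) G,
        G 0 = 0,
        forall v, sball W delta r v -> F (G v) = v &
        forall v, sball W delta r v -> snorm V s1 (G v) <= r^-1 * snorm W delta v].
Proof.
have s01 : s0 <= s1.
  by apply: le_trans hs1; rewrite lerDl le_max hm.
have [y [eps [kap [tau [beta [[y0 y1 eps0 kap0] [t1 t2 t3 t4] [R1 R2 R3 R4]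
  [E1 E2 E3]]]]]]] := nash_moser_exponents hs0 hm hl hl' s01 hdelta.
(* The estimates of L(u) are used up to index [tau], which requires tau <= S - max(l, l'). *)
exists (tau + Num.max l l') => S hS V W F DF F_in [F_diff [a a0 DF_tame]] F0 [b b0 Linv] Fgal.
have [A HA] := tame_bound_exists V; have [A' HA'] := tame_bound_exists W.
have A1 : 1 <= A by case: HA. have A'1 : 1 <= A' by case: HA'.
pose c := A + A' + a + b.
have Hc : tame_bound V c by apply: tame_boundW HA; rewrite /c; lra.
have Hc' : tame_bound W c by apply: tame_boundW HA'; rewrite /c; lra.
have ac : a <= c by rewrite /c; lra.
have bc : b <= c by rewrite /c; lra.
have c1 : 1 <= c by case: Hc.
clearbody c; have c0 : 0 < c by apply: lt_le_trans c1.
have tl : tau + l <= S by apply: le_trans (ltW hS); rewrite lerD2l le_max lexx.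
have tl' : tau + l' <= S by apply: le_trans (ltW hS); rewrite lerD2l le_max lexx orbT.
have [i1 [i2 [i3 [i4 [i5 [i6 [i7 [i8 [i9 [i10 i11]]]]]]]]]] :
   0 <= s1 /\ s1 <= S /\ 0 <= delta /\ delta <= S /\ s0 + l' <= delta /\
   0 <= s0 + m /\ s0 + m <= S /\ s0 <= S /\ s0 <= delta /\ s0 <= S - m /\ s0 + m <= s1.
  have : m <= Num.max m l by rewrite le_max lexx.
  by move: hs0 hm hl hl' hs1 hdelta t1 t3 t4 kap0 tl s01; clear; lra.
have j1 : s0 <= tau - m by move: t1 kap0; clear; lra.
have j2 : tau - m <= S - m by move: tl hl; clear; lra.
have j3 : tau - m <= S by move: tl hl hm; clear; lra.
have j4 : 0 <= tau - m by move: j1 hs0; clear; lra.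
have j5 : tau <= S by move: tl hl; clear; lra.
have j6 : 0 <= tau by move: t3 i1; clear; lra.
have DFc s : s0 <= s -> s <= S - m -> forall u h, sball V (s0 + m) 1 u ->
    sspace V (s + m) u -> sspace V (s + m) h -> sspace W s (DF u h) /\
    snorm W s (DF u h) <=
      c * (snorm V (s + m) h + snorm V (s + m) u * snorm V (s0 + m) h).
  move=> h1 h2 u h bu su sh; have [H1 H2] := DF_tame s h1 h2 u h bu su sh.
  have k1 : 0 <= s + m by move: h1 hs0 hm; clear; lra.
  have k2 : s + m <= S by move: h2; clear; lra.
  have k3 : s0 + m <= s + m by rewrite lerD2r.
  split=> //; apply: le_trans H2 _; rewrite ler_wpM2r// addr_ge0 ?mulr_ge0//.
  - exact: (snorm_ge0 k1 k2).
  - exact: (snorm_ge0 k1 k2).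
  - by apply: (snorm_ge0 i6 i7); apply: sspace_sub sh.
have Lc u : sball V (s0 + Num.max m l) 1 u -> exists Lu : W -> V,
    (forall k, sspace W (s0 + l') k -> sspace V (s0 + m) (Lu k) -> DF u (Lu k) = k) /\
    forall s, s0 <= s -> s <= S - Num.max l l' -> sspace V (s + l) u ->
      forall k, sspace W (s + l') k -> sspace V s (Lu k) /\
      snorm V s (Lu k) <=
        c * (snorm W (s + l') k + snorm W (s0 + l') k * snorm V (s + l) u).
  move=> /Linv[Lu [_ _ H1 H2]]; exists Lu; split=> // s h1 h2 su k sk.
  have [H3 H4] := H2 s h1 h2 su k sk.
  have [k1 [k2 [k3 [k4 k5]]]] : 0 <= s + l' /\ s + l' <= S /\ 0 <= s + l /\ s + l <= S /\
      s0 + l' <= s + l'.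
    have : l <= Num.max l l' by rewrite le_max lexx.
    have : l' <= Num.max l l' by rewrite le_max lexx orbT.
    by move: h1 h2 hs0 hl hl'; clear; lra.
  split=> //; apply: le_trans H4 _; rewrite ler_wpM2r// addr_ge0 ?mulr_ge0//.
  - exact: (snorm_ge0 k1 k2).
  - have k6 : 0 <= s0 + l' by rewrite addr_ge0.
    by apply: (snorm_ge0 k6 (le_trans k5 k2)); apply: sspace_sub sk.
  - exact: (snorm_ge0 k3 k4).
have [lam Hlam] : exists lam : nat -> R, forall n, [/\ 1 <= lam n,
    lam n.+1 `^ y = lam n & 16 * c ^+ 5 * 2 ^+ n <= lam n `^ eps].
  apply: growth_sequence => //.
  by have : 1 <= c ^+ 5 by [rewrite exprn_ege1]; clear; lra.
have lam1 n : 1 <= lam n by case: (Hlam n).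
have lam0 n : 0 < lam n by apply: lt_le_trans (lam1 n).
pose hn n : R := 2^-1 ^+ n.
have hn0 n : 0 < hn n by rewrite exprn_gt0// invr_gt0.
have hnS n : hn n = hn n.+1 + hn n.+1 by rewrite /hn exprS; field.
have hnW n : hn n.+1 <= hn n by rewrite (hnS n) lerDl ltW.
have c45 : c ^+ 4 <= c ^+ 5 by rewrite ler_weXn2l.
have lamh n : 16 * c ^+ 5 * lam n `^ (- eps) <= hn n.
  have [_ _ H] := Hlam n; rewrite powRN ler_pdivrMr ?powR_gt0//.
  by rewrite /hn exprVn [leRHS]mulrC ler_pdivlMr ?exprn_gt0.
have c51 : 1 <= c ^+ 5 by rewrite exprn_ege1.
have lamh' n : lam n `^ (- eps) <= hn n.
  apply: le_trans (lamh n); rewrite ler_peMl ?powR_ge0//.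
  by move: c51; clear; lra.
pose p1 := lam 1%N `^ (- (s1 - s0) - eps).
have p10 : 0 < p1 by rewrite powR_gt0.
(* The first step works at frequency [lam 1], and its target bound asks for 8 c^2 r <= p1; the later
   steps only need 8 c^2 r <= 1. *)
pose r := Num.min p1 1 / (8 * c ^+ 2).
have c20 : 0 < 8 * c ^+ 2 by rewrite mulr_gt0// exprn_gt0.
have r0 : 0 < r by rewrite divr_gt0// lt_min p10 ltr01.
have r_p1 : 8 * c ^+ 2 * r <= p1.
  by rewrite /r mulrC divfK ?gt_eqF// ge_min lexx.
have r_1 : 8 * c ^+ 2 * r <= 1.
  by rewrite /r mulrC divfK ?gt_eqF// ge_min lexx orbT.
clearbody r.
(* The parameter space is the Banach model of W_delta, which carries that norm as its own; [j] is
   the inclusion into W. *)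
have [B [j [jI jR jN]]] := sspace_banach W i3 i4.
have sj x : sspace W delta (j x) by rewrite -jR; exists x.
pose P : set B := [set x | `|x| < r].
pose eta (x : B) := `|x| / r.
have eta0 x : P x -> 0 <= eta x by move=> _; rewrite divr_ge0// ltW.
have eta1 x : P x -> eta x < 1 by rewrite /eta ltr_pdivrMr// mul1r.
have jeta x : snorm W delta (j x) <= r * eta x.
  by rewrite jN /eta mulrC divfK// gt_eqF.
(* The target 0 at rank 0 is matched by the zero map, since F(0) = 0; the iteration starts from
   it. *)
pose T n x : W := if n is k.+1 then proj W (lam k `^ y) (j x) else 0.
pose cont (f : B -> V) := forall x, P x -> forall e : R, 0 < e -> exists2 d : R, 0 < d &
  forall x', P x' -> `|x - x'| < d -> snorm V s1 (f x - f x') < e.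
(* The factor 1 - 2^(-n) is the sum of the increments made so far; it stays below 1, so the iterates
   never leave the unit ball of V_s1. *)
pose Inv n (g : B -> V) := [/\ forall x, P x -> proj V (lam n) (g x) = g x,
  forall x, P x -> snorm V s1 (g x) <= (1 - hn n) * eta x,
  forall x, P x -> snorm V tau (g x) <= lam n `^ beta * eta x,
  forall x, P x -> proj W (lam n `^ y) (F (g x)) = T n x & cont g].
have step n g : Inv n g -> exists g', Inv n.+1 g' /\
    forall x, P x -> snorm V s1 (g' x - g x) <= hn n.+1 * eta x.
  move=> [I1 I2 I3 I4 I5].
  have [L1 ML Llarge] := Hlam n.+1.
  have [_ {}ML _] := Hlam n; have M1 := lam1 n.
  pose L := lam n.+1; rewrite -/L in L1 ML Llarge.
  have LM : L `^ y = lam n by [].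
  have mu1 : 1 <= lam n `^ y by rewrite powR_ge1// ltW.
  have muE : lam n `^ y = (L `^ y) `^ y by rewrite LM.
  have tw x : P x ->
      snorm W (s0 + l') (T n x - T n.+1 x) <= L `^ (- (s1 - s0) - eps) * (eta x / 8) /\
      snorm W (tau + l') (T n x - T n.+1 x) <= L `^ (beta - eps) * (eta x / 8).
    move=> Px; case: n @L {I1 I2 I3 I4 I5 ML M1 L1 Llarge} LM mu1 muE => [|n] L LM mu1 muE.
      rewrite /T sub0r.
      have k1 : 0 <= s0 + l' by rewrite addr_ge0.
      have k2 : 0 <= tau + l' by rewrite addr_ge0.
      have k3 := le_trans i5 i4; have sP x' k : 0 <= k -> k <= S ->
        sspace W k (proj W (lam 0%N `^ y) x') by exact: proj_sspace.
      rewrite (snormN k1 k3 (sP _ _ k1 k3)) (snormN k2 tl' (sP _ _ k2 tl')).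
      exact: (first_target_bound muE hs0 hl' y0 i5 t4 tl' R2 Hc' (lam1 _) (ltW r0)
        r_1 r_p1 (eta0 _ Px) (sj _) (jeta _)).
    rewrite /T.
    have mE : lam n `^ y = (lam n.+1 `^ y) `^ y by have [_ -> _] := Hlam n.
    exact: (next_target_bound muE mE hs0 hl' y0 eps0 i5 t4 tl' R1 R2 Hc' (lam1 _) r_1
      y1 (eta0 _ Px) (sj _) (jeta _)).
  have c16 : 16 * c ^+ 5 <= L `^ eps.
    apply: le_trans Llarge; rewrite ler_peMr ?exprn_ege1 ?ler1n//.
    by rewrite mulr_ge0// (le_trans ler01).
  have incr : 8 * c ^+ 4 * L `^ (- eps) <= hn n.+1.
    apply: le_trans (lamh n.+1); rewrite ler_wpM2r ?powR_ge0//.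
    by move: c45 c51; clear; lra.
  have I1' x : P x -> proj V (L `^ y) (g x) = g x by rewrite LM; exact: I1.
  have I3' x : P x -> snorm V tau (g x) <= (L `^ y) `^ beta * eta x.
    by rewrite LM; exact: I3.
  have I4' x : P x -> proj W ((L `^ y) `^ y) (F (g x)) = T n x.
    by rewrite LM; exact: I4.
  have wf x : P x -> proj W ((L `^ y) `^ y) (T n.+1 x) = T n.+1 x.
    by rewrite LM /T proj_idem.
  have wc x : P x -> forall e : R, 0 < e -> exists2 d : R, 0 < d &
      forall x', P x' -> `|x - x'| < d -> snorm W s0 (T n.+1 x - T n.+1 x') < e.
    move=> _ e e0; exists (e / c); first by rewrite divr_gt0.
    move=> x' _; rewrite ltr_pdivlMr// mulrC; apply: le_lt_trans.
    rewrite /T -linearB -linearB/=.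
    have sd : sspace W s0 (j (x - x')) by apply: sspace_sub (sj _).
    apply: le_trans (projW Hc' hs0 (lexx _) i8 mu1 sd) _; rewrite ler_pM2l//.
    by rewrite -jN; apply: snorm_le (sj _).
  have hn1 : hn n <= 1 by rewrite exprn_ile1// ?invr_ge0// invf_le1// ler1n.
  have r1s : 0 <= 1 - hn n /\ 1 - hn n + 8 * c ^+ 4 * L `^ (- eps) <= 1.
    split; first by rewrite subr_ge0.
    by move: incr (hnW n); clear; lra.
  have [g' [G1 G2 G3 G4 G5]] := nash_moser_step hs0 hm hl hl' hs1 Hc Hc' y0 y1 eps0
    kap0 t1 t2 t3 tl tl' R3 R4 E1 E2 E3 F_diff F0 DFc Lc Fgal L1 c16 eta0 eta1
    I1' I2 I3' I4' I5 wf wc (fun x Px => (tw x Px).1) (fun x Px => (tw x Px).2) r1s.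
  have inc x : P x -> snorm V s1 (g' x - g x) <= hn n.+1 * eta x.
    by move=> Px; apply: le_trans (G3 x Px) _; rewrite ler_wpM2r// eta0.
  exists g'; split=> //; split=> //.
  move=> x Px; rewrite -[g' x](subrK (g x)).
  have sg' : sspace V s1 (g' x) by apply: fixed_sspace (G1 x Px) _ _.
  have sg : sspace V s1 (g x) by apply: fixed_sspace (I1 x Px) _ _.
  apply: le_trans (snormD i1 i2 (sspaceB i1 i2 sg' sg) sg) _.
  apply: le_trans (lerD (inc x Px) (I2 x Px)) _.
  by rewrite -mulrDl (hnS n) le_eqVlt; apply/orP; left; apply/eqP; ring.
have Inv0 : Inv 0%N (fun=> 0).
  split.
  - by move=> x _; rewrite linear0.
  - by move=> x _; rewrite snorm_zero// /hn expr0 subrr mul0r.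
  - by move=> x Px; rewrite snorm_zero// mulr_ge0 ?powR_ge0 ?eta0.
  - by move=> x _; rewrite F0 linear0.
  - by move=> x _ e e0; exists 1 => // x' _ _; rewrite subrr snorm_zero.
have /choice[next Hnext] (ng : nat * (B -> V)) : exists g', Inv ng.1 ng.2 ->
    Inv ng.1.+1 g' /\
    forall x, P x -> snorm V s1 (g' x - ng.2 x) <= hn ng.1.+1 * eta x.
  have [I|] := pselect (Inv ng.1 ng.2); last by exists ng.2.
  by have [g' H] := step _ _ I; exists g'.
pose G := fix G n := if n is k.+1 then next (k, G k) else (fun=> 0 : V).
have GI n : Inv n (G n).
  by elim: n => [|n IH]; [exact: Inv0|have [] := Hnext (n, G n) IH].
have GS n x : P x -> snorm V s1 (G n.+1 x - G n x) <= hn n.+1 * eta x.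
  by move=> Px; have [_] := Hnext (n, G n) (GI n); apply.
have Gs n x k : P x -> 0 <= k -> k <= S -> sspace V k (G n x).
  by move=> Px k0 kS; have [/(_ x Px) Pg _ _ _ _] := GI n; apply: fixed_sspace Pg _ _.
have Gs1 n x : P x -> sspace V s1 (G n x) by move=> Px; exact: Gs.
have Gk n k x : P x -> snorm V s1 (G (k + n)%N x - G n x) <= (hn n - hn (k + n)%N) * eta x.
  move=> Px; elim: k => [|k IH]; first by rewrite !subrr mul0r snorm_zero.
  rewrite addSn -[G _ x](subrK (G (k + n)%N x)) -addrA.
  apply: le_trans (snormD i1 i2 (sspaceB i1 i2 _ _) (sspaceB i1 i2 _ _)) _; try exact: Gs1.
  apply: le_trans (lerD (GS _ _ Px) IH) _; rewrite -mulrDl (hnS (k + n)%N).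
  by rewrite le_eqVlt; apply/orP; left; apply/eqP; ring.
have Gk' n k x : P x -> snorm V s1 (G (k + n)%N x - G n x) <= hn n * eta x.
  move=> Px; apply: le_trans (Gk n k x Px) _; rewrite ler_wpM2r ?eta0//.
  by rewrite gerBl ltW.
have lim_ex x : P x -> exists2 u, sspace V s1 u &
    forall e : R, 0 < e -> exists n, forall i, (n <= i)%N -> snorm V s1 (G i x - u) < e.
  move=> Px; apply: (snorm_complete i1 i2 (fun n => Gs1 n x Px)) => e e0.
  have [n Hn] := half_pow_lt (2 * eta x) e0; exists n => i k ni nk.
  have := Gk' n (i - n)%N x Px; have := Gk' n (k - n)%N x Px; rewrite !subnK// => h1 h2.
  have -> : G i x - G k x = (G i x - G n x) - (G k x - G n x) by rewrite opprB addrA subrK.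
  apply: le_lt_trans (snormB i1 i2 (sspaceB i1 i2 _ _) (sspaceB i1 i2 _ _)) _; try exact: Gs1.
  by move: Hn h1 h2; rewrite -/(hn n); move: (hn n) (eta x) => ? ?; clear; lra.
have /choice[Gl HGl] x : exists u, P x -> sspace V s1 u /\
    forall n, snorm V s1 (G n x - u) <= hn n * eta x.
  have [Px|] := pselect (P x); last by exists 0.
  have [u su Hu] := lim_ex x Px; exists u => _; split=> // n.
  apply/ler_addgt0Pr => e e0; have [N HN] := Hu e e0.
  have := HN (N + n)%N (leq_addr _ _); have := Gk' n N x Px => h1 h2.
  have -> : G n x - u = (G (N + n)%N x - u) - (G (N + n)%N x - G n x).
    by rewrite opprB [RHS]addrC addrA subrK.
  apply: le_trans (snormB i1 i2 (sspaceB i1 i2 _ su) (sspaceB i1 i2 _ _)) _; try exact: Gs1.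
  by move: h1 h2; clear; lra.
have Gl_bound x : P x -> snorm V s1 (Gl x) <= eta x.
  move=> Px; have [su Hu] := HGl x Px; rewrite -subr_le0.
  apply: (@le0_half_pow _ 0) => n; rewrite mul0r subr_le0.
  have [_ /(_ x Px) h1 _ _ _] := GI n; have h2 := Hu n.
  have -> : Gl x = G n x - (G n x - Gl x) by rewrite subKr.
  apply: le_trans (snormB i1 i2 (Gs1 n x Px) (sspaceB i1 i2 (Gs1 n x Px) su)) _.
  by apply: le_trans (lerD h1 h2) _; rewrite -mulrDl subrK mul1r.
have Gl_ball x : P x -> sball V s1 1 (Gl x).
  move=> Px; split; first by case: (HGl x Px).
  exact: le_lt_trans (Gl_bound x Px) (eta1 x Px).
(* As [eta] is below 1 on [P], the convergence is uniform there and continuity passes to the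
   limit. *)
have Gl_cont : cont Gl.
  move=> x Px e e0; have e30 : 0 < e / 3 by rewrite divr_gt0.
  have [n] := half_pow_lt 1 e30; rewrite mul1r -/(hn n) => Hn.
  have [_ _ _ _ /(_ x Px _ e30)[d d0 Hd]] := GI n.
  exists d => // x' Px' xx'; have h1 := Hd x' Px' xx'.
  have hlt z : P z -> snorm V s1 (G n z - Gl z) < e / 3.
    move=> Pz; have [_ /(_ n) h2] := HGl z Pz; apply: le_lt_trans Hn.
    by apply: le_trans h2 _; rewrite ler_piMr// ltW// eta1.
  have [sx _] := HGl x Px; have [sx' _] := HGl x' Px'.
  have -> : Gl x - Gl x' = (G n x - G n x') - (G n x - Gl x) + (G n x' - Gl x').
    by rewrite opprB [_ + (Gl x - _)]addrC !subrKA.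
  apply: le_lt_trans (snormD i1 i2 _ _) _.
  - by apply: (sspaceB i1 i2); apply: (sspaceB i1 i2) => //; exact: Gs1.
  - by apply: (sspaceB i1 i2) => //; exact: Gs1.
  have := snormB i1 i2 (sspaceB i1 i2 (Gs1 n x Px) (Gs1 n x' Px'))
    (sspaceB i1 i2 (Gs1 n x Px) sx).
  by move: h1 (hlt x Px) (hlt x' Px'); clear; lra.
have Gl_sol x : P x -> F (Gl x) = j x.
  move=> Px; have [sx Hx] := HGl x Px; have e1 := eta1 x Px.
  have ball_m u : sball V s1 1 u -> sball V (s0 + m) 1 u by apply: sballW.
  have bl := ball_m _ (Gl_ball x Px).
  have bn n : sball V (s0 + m) 1 (G n x).
    apply: ball_m; split; first exact: Gs1.
    have [_ /(_ x Px) h _ _ _] := GI n; apply: le_lt_trans h _; apply: le_lt_trans e1.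
    by rewrite ler_piMl ?eta0// gerBl ltW.
  have sj0 : sspace W s0 (j x) by apply: sspace_sub (sj x).
  have sF : sspace W s0 (F (Gl x)) by exact: F_in.
  apply/eqP; rewrite -subr_eq0; apply/eqP.
  have sD : sspace W s0 (F (Gl x) - j x) by exact: sspaceB.
  apply: (snorm_eq0 hs0 i8 sD).
  apply/eqP; rewrite eq_le snorm_ge0// andbT.
  (* The three terms bound the effect of F on the distance to the limit, the part of F(u) above the
     projection, and the part of the datum above the target; each is a constant times 2^(-n). *)
  apply: (@le0_half_pow _ (2 * c + 2 * c ^+ 2 + c * `|x|)) => n; rewrite -/(hn n).
  pose u := G n.+1 x.
  have su k : 0 <= k -> k <= S -> sspace V k u by exact: Gs.
  have [sd1 d1] := F_lipschitz hs0 hm F_diff c0 DFc i10 (bn n.+1) bl.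
  have sum : sspace V (tau - m + m) u by rewrite subrK; apply: su.
  have [sFu NFu] := F_tame hs0 hm F_diff c0 DFc F0 j1 j2 (bn n.+1) sum.
  have [_ _ /(_ x Px) uh /(_ x Px) us _] := GI n.+1; rewrite -/u in d1 sd1 NFu sFu uh us *.
  have mu n' : 1 <= lam n' `^ y by rewrite powR_ge1// ltW.
  have d2 := projC Hc' hs0 j1 j3 (mu n.+1) sFu.
  have d3 := projC Hc' hs0 i9 i4 (mu n) (sj x).
  rewrite us in d2; rewrite -[proj W _ (j x)]/(T n.+1 x) in d3.
  have sT : sspace W s0 (T n.+1 x) by exact: proj_sspace.
  have sFu0 : sspace W s0 (F u) by apply: F_in; exact: bn.
  have -> : F (Gl x) - j x = (F (Gl x) - F u) + (F u - T n.+1 x) - (j x - T n.+1 x).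
    by rewrite opprB !subrKA.
  apply: le_trans (snormB hs0 i8 _ _) _; try exact: sspaceB.
    by apply: sspaceD => //; exact: sspaceB.
  have -> : (2 * c + 2 * c ^+ 2 + c * `|x|) * hn n =
      2 * c * hn n + 2 * c ^+ 2 * hn n + c * `|x| * hn n by ring.
  apply: lerD.
    apply: le_trans (snormD hs0 i8 _ _) _; try exact: sspaceB.
    apply: lerD.
      apply: le_trans d1 _. rewrite ler_pM2l ?mulr_gt0//.
      apply: (@le_trans _ _ (snorm V s1 (Gl x - u))).
        by apply: snorm_le => //; apply: sspaceB => //; exact: Gs1.
      rewrite (snorm_distC i1 i2 sx (Gs1 n.+1 x Px)).
      apply: le_trans (Hx n.+1) _; apply: (@le_trans _ _ (hn n.+1 * 1)).
        by rewrite ler_pM2l// ltW.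
      by rewrite mulr1.
    apply: le_trans d2 _.
    have NFu' : snorm W (tau - m) (F u) <= 2 * c * lam n.+1 `^ beta.
      apply: le_trans NFu _; rewrite ler_pM2l ?mulr_gt0// subrK.
      by apply: le_trans uh _; rewrite ler_piMr ?powR_ge0// ltW.
    rewrite -powRrM; set e := y * _.
    apply: (@le_trans _ _ (c * lam n.+1 `^ e * (2 * c * lam n.+1 `^ beta))).
      by rewrite ler_wpM2l// mulr_ge0 ?powR_ge0// ltW.
    have -> : c * lam n.+1 `^ e * (2 * c * lam n.+1 `^ beta) =
        2 * c ^+ 2 * (lam n.+1 `^ e * lam n.+1 `^ beta) by ring.
    rewrite ler_pM2l ?mulr_gt0 ?exprn_gt0// powR_add//.
    apply: (@le_trans _ _ (lam n.+1 `^ (- eps))).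
      rewrite ler_powR// /e.
      have : y * (s1 - s0 + 2 * eps) <= s1 - s0 + 2 * eps.
        by rewrite ler_piMl ?(ltW y1)// addr_ge0 ?subr_ge0// mulr_ge0// ltW.
      (* Here the projection has frequency M = L^y instead of M1, so [R3] is used after division by
         y. *)
      have : s1 - s0 + 2 * eps <= y * (y * (tau - m - s0 - l') - beta).
        by apply: le_trans R3 _; rewrite le_eqVlt; apply/orP; left; apply/eqP; ring.
      move=> h1 h2; have := le_trans h2 h1; rewrite ler_pM2l// => h3.
      have : y * (tau - m - s0 - l') <= y * (tau - m - s0).
        by rewrite ler_pM2l// gerBl.
      have : 0 <= s1 - s0 by rewrite subr_ge0.
      have -> : y * - (tau - m - s0) = - (y * (tau - m - s0)) by ring.
      by move: h3 eps0; clear; lra.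
    exact: le_trans (lamh' _) (hnW n).
  apply: le_trans d3 _; rewrite jN -powRrM.
  have -> : c * `|x| * hn n = c * hn n * `|x| by ring.
  rewrite ler_wpM2r// ler_pM2l//; apply: le_trans (lamh' n).
  rewrite ler_powR//.
  have : y * (y * y) * (delta - s0 - l') <= y * (delta - s0).
    rewrite -mulrA ler_pM2l//.
    apply: (@le_trans _ _ (delta - s0 - l')); last by rewrite gerBl.
    rewrite ler_piMl//; last by rewrite mulr_ile1// ltW.
    by move: i5; clear; lra.
  have -> : y * - (delta - s0) = - (y * (delta - s0)) by ring.
  by move: R1 s01 eps0; clear; lra.
(* A left inverse of [j], with an arbitrary value outside W_delta, where G is not constrained. *)
have /choice[ji Hji] v : exists x : B, (exists x', j x' = v) -> j x = v.
  have [[x' <-]|] := pselect (exists x', j x' = v); last by exists 0.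
  by exists x'.
have jiK x : ji (j x) = x by apply: jI; apply: Hji; exists x.
have ballP v : sball W delta r v -> exists2 x, P x & v = j x.
  by rewrite /sball -jR => -[[x _ <-]]; rewrite jN => xr; exists x.
exists r; split=> //; exists (fun v => Gl (ji v)); split.
- by move=> v /ballP[x Px ->]; rewrite jiK; exact: Gl_ball.
- move=> v /ballP[x Px ->] e e0; rewrite jiK; have [d d0 Hd] := Gl_cont x Px e e0.
  exists d => // v' /ballP[x' Px' ->]; rewrite jiK -linearB jN distrC => xx'.
  rewrite (snorm_distC i1 i2); [exact: Hd|by case: (Gl_ball x' Px')|by case: (Gl_ball x Px)].
- have P0 : P 0 by rewrite /P /= normr0.
  have j0 : j 0 = 0 by rewrite linear0.
  rewrite -j0 jiK; apply: (snorm_eq0 i1 i2); first by case: (Gl_ball 0 P0).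
  apply/eqP; rewrite eq_le (snorm_ge0 i1 i2) ?andbT; last by case: (Gl_ball 0 P0).
  by apply: le_trans (Gl_bound 0 P0) _; rewrite /eta normr0 mul0r.
- by move=> v /ballP[x Px ->]; rewrite jiK; exact: Gl_sol.
- by move=> v /ballP[x Px ->]; rewrite jiK jN mulrC; exact: Gl_bound.
Qed.
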